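(* Let $\alpha>0$ and let $(u_N(\alpha))_{N\ge1}$ be any sequence of positive numbers with $u_N(\alpha)\sim\frac2\pi\alpha\log^2N$ as $N\to\infty$. Then the law of $(1\{x\in\mathcal{I}^{u_N(\alpha)}\})_{x\in\mathbb{Z}^2}$ under $\mathbb{P}^{0,N}$ converges weakly (in the sense of finite-dimensional marginals) as $N\to\infty$ towards $Q^\alpha$.
   Context: $P_x$ is the law of the continuous-time simple random walk $(X_t)_{t\ge0}$ on $\mathbb{Z}^2$ with exponential holding times of parameter $1$ started at $x$; $\tau_1$ is its first jump time. $H_A=\inf\{t\ge0:X_t\in A\}$, $\widetilde H_A=\inf\{t\ge\tau_1:X_t\in A\}$, $T_A=H_{\mathbb{Z}^2\setminus A}$, $H_0=H_{\{0\}}$ ($\inf\emptyset=\infty$). $B_N=\{x\in\mathbb{Z}^2:|x|\le N\}$ is the Euclidean ball. Let $x_*\notin\mathbb{Z}^2$ be a cemetery point. $W$ is the set of right-continuous piecewise constant $w:\mathbb{R}\to\mathbb{Z}^2\cup\{x_*\}$, with nearest-neighbour jumps inside $\mathbb{Z}^2$, such that the forward part ($t\to+\infty$) and the backward part ($t\to-\infty$) each either reach $x_*$ after finitely many jumps and stay there forever, or stay in $\mathbb{Z}^2$ and leave every finite set in finite time. $W$ carries the $\sigma$-algebra generated by the coordinates; $W^*$ is the quotient of $W$ by time-shifts, with projection $\pi^*$ and induced $\sigma$-algebra; $W_A^*$ is the image under $\pi^*$ of the trajectories visiting $A$. For $0\in A\subset B_N$, $Q_A^{0,N}$ is the finite measure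 on $W$ under which: $w(0)=x\in A$ has mass $P_x[\widetilde H_A>T_{B_N}]\,P_x[H_0>T_{B_N}]$; given $w(0)=x$, $(w(t))_{t\ge0}$ is distributed as $X$ under $P_x[\,\cdot\,|H_0>T_{B_N}]$, set equal to $x_*$ from time $T_{B_N}$ on; and, independently, $w(s)=\lim_{r\uparrow-s}Y_r$ for $s<0$, where $Y_t=X_{\tau_1+t}$, set equal to $x_*$ from the moment $X$ exits $B_N$ on, under $P_x[\,\cdot\,|\widetilde H_A>T_{B_N}]$. $\nu^{0,N}$ is the unique finite measure on $W^*$ concentrated on $W^*_{B_N}$ with $1_{W_A^*}\nu^{0,N}=\pi^*\circ Q_A^{0,N}$ for all $0\in A\subset B_N$. Under $\mathbb{P}^{0,N}$, $\omega=\sum_i\delta_{(w_i^*,u_i)}$ is a Poisson point measure on $W^*\times[0,\infty)$ with intensity $\nu^{0,N}(dw^* )\,du$; $L_{x,u}=\sum_i1\{u_i\le u\}\int_{-\infty}^\infty1\{w_i(t)=x\}\,dt$ with $w_i$ any representative of $w_i^*$, and $\mathcal{I}^u=\{x\in\mathbb{Z}^2:L_{x,u}>0\}$. $p_k(x)$ is the probability that the discrete-time simple random walk from $0$ is at $x$ at time $k$; $a(x)=\lim_n\sum_{k=0}^n(p_k(0)-p_k(x))$; $\mathrm{hm}_A(x)=\lim_{|y|\to\infty}P_y[X_{\widetilde H_A}=x]$; for finite $A\ni0$, $\mathrm{cap}(A)=\sum_{x\in A}a(x)\mathrm{hm}_A(x)$. $Q^\alpha$ is the probability measure on $\{0,1\}^{\mathbb{Z}^2}$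 (product $\sigma$-algebra, coordinates $\widetilde Y_x$) characterized by $Q^\alpha(\widetilde Y_x=0,\ x\in A)=e^{-\frac\pi2\alpha\,\mathrm{cap}(A)}$ for all finite $A\ni0$. $f\sim g$ means that the ratio tends to $1$. *)

(* Defs.v *)
From HB Require Import structures.
From mathcomp Require Import all_boot all_order all_algebra.
From mathcomp Require Import all_classical all_reals all_analysis.
From mathcomp Require Import measurable_realfun.
Set Implicit Arguments.
Unset Strict Implicit.
Unset Printing Implicit Defensive.
Import Order.TTheory GRing.Theory Num.Theory.
Import numFieldNormedType.Exports.
Local Open Scope classical_set_scope.
Local Open Scope ring_scope.
Local Open Scope quotient_scope.

Notation Z2 := (int * int)%type.

Definition step (i : 'I_4) : Z2 :=
  nth 0 [:: (1, 0); (-1, 0); (0, 1); (0, -1)] i.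

Definition adj (x y : Z2) : bool := [exists i, y == x + step i].

Definition enorm (R : realType) (x : Z2) : R :=
  Num.sqrt (x.1%:~R ^+ 2 + x.2%:~R ^+ 2).

Definition eball (R : realType) (N : nat) : set Z2 :=
  [set x | enorm R x <= N%:R].

Definition at_infinity (R : realType) : set_system Z2 :=
  [set E | exists r : R, forall y, r < enorm R y -> E y].

(* The family (P_x) of laws of the walk, realized on one measurable space that
   carries the jump chain and the holding times; [srw_lawE] says that under P_x
   the chain is the discrete simple random walk from x and that the holding
   times are i.i.d. exponential of parameter 1, independent of the chain.  As
   on the space of paths with locally finitely many jumps, positivity of the
   holding times and absence of explosion hold everywhere, not only a.s. *)
Structure srw (R : realType) := Srw {
  srw_display : measure_display;
  srw_space :> measurableType srw_display;
  srw_law : Z2 -> probability srw_space R;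
  jump_chain : nat -> srw_space -> Z2;
  hold : nat -> srw_space -> R;
  measurable_jump_chain :
    forall n x, measurable (jump_chain n @^-1` [set x]);
  measurable_hold : forall n, measurable_fun setT (hold n);
  hold_gt0 : forall n o, 0 < hold n o;
  hold_cvgy : forall o, (\sum_(i < n) hold i o) @[n --> \oo] --> +oo;
  srw_lawE : forall x n (z : nat -> Z2) (B : nat -> set R),
    (forall i, measurable (B i)) ->
    srw_law x
      [set o | forall i, (i <= n)%N -> jump_chain i o = z i /\ B i (hold i o)]
    = (((z 0%N == x)%:R * \prod_(i < n) ((adj (z i) (z i.+1))%:R / 4%:R))%:E
       * \prod_(i < n.+1) exponential_prob 1 (B i))%E
}.

Section walk.
Context {R : realType} (S : srw R).
Local Notation P := (srw_law S).
Implicit Types (o : S) (A E C : set Z2) (N : nat) (x y : Z2).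

Definition jump_time n o : R := \sum_(i < n) hold i o.

(* For t >= 0 there is exactly one such n. *)
Definition X (t : R) o : Z2 :=
  jump_chain (xget 0%N [set n | jump_time n o <= t < jump_time n.+1 o]) o.

Definition hit_from (s : R) A o : \bar R :=
  ereal_inf [set t%:E | t in [set t | s <= t /\ A (X t o)]].
Definition hit A o := hit_from 0 A o.
Definition hit_after A o := hit_from (jump_time 1 o) A o.
Definition exit A o := hit (~` A) o.

Definition avoid0 N : set S := [set o | exit (eball R N) o < hit [set 0%R : Z2] o]%E.
Definition avoid_after A N : set S :=
  [set o | exit (eball R N) o < hit_after A o]%E.

Definition harmonic_measure A x : R :=
  lim ((fun y => fine (P y [set o | (hit_after A o < +oo)%E /\
                                    X (fine (hit_after A o)) o = x]))
         @ at_infinity R).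

End walk.

(* The n-step law of a sum of k i.i.d. steps uniform on the four neighbours. *)
Definition step_sum_prob (R : realType) (k : nat) (x : Z2) : R :=
  #|[set s : k.-tuple 'I_4 | \sum_(j < k) step (tnth s j) == x]%SET|%:R
  / 4%:R ^+ k.

Definition potential_kernel (R : realType) (x : Z2) : R :=
  lim ((\sum_(k < n.+1) (step_sum_prob R k 0 - step_sum_prob R k x)) @[n --> \oo]).

Definition capacity (R : realType) (S : srw R) (A : set Z2) : R :=
  \sum_(x \in A) (potential_kernel R x * harmonic_measure S A x).

(* [None] is the cemetery point x_*. *)
Definition traj (R : realType) := R -> option Z2.

Section trajectories.
Context {R : realType}.
Implicit Types w : traj R.

Definition discontinuities w : set R :=
  [set t | ~ \forall s \near t, w s = w t].

Definition leaves_finite_sets w (F : set_system R) : Prop :=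
  forall K : set Z2, finite_set K ->
    \forall t \near F, exists2 x, ~ K x & w t = Some x.

(* [traj_lifetime]: once the forward (resp. backward) part has left Z^2 for
   the cemetery point, it never comes back. *)
Record is_traj w : Prop := IsTraj {
  traj_right_continuous : forall t, \forall s \near t^'+, w s = w t;
  traj_piecewise_constant :
    forall a b, finite_set (discontinuities w `&` `[a, b]);
  traj_nearest_neighbour : forall t x y,
    (\forall s \near t^'-, w s = Some x) -> w t = Some y -> x <> y -> adj x y;
  traj_lifetime : is_interval [set t | w t <> None];
  traj_forward : (\forall t \near +oo, w t = None) \/
                 leaves_finite_sets w (pinfty_nbhs R);
  traj_backward : (\forall t \near -oo, w t = None) \/
                  leaves_finite_sets w (ninfty_nbhs R)
}.

Definition coord_sigma (I : set R) : set_system (traj R) :=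
  <<s [set E | exists t z, I t /\ E = [set w | w t = z]] >>.

Lemma is_traj_None : is_traj (fun=> None).
Proof.
split.
- by move=> t; apply: nearW.
- move=> a b; apply: (sub_finite_set _ (finite_set0 R)) => t [+ _].
  by apply; apply: (@nearW _ (nbhs t)).
- by [].
- by move=> x y /=.
- by left; apply: nearW.
- by left; apply: nearW.
Qed.

End trajectories.

Definition W (R : realType) := {w : traj R | `[< is_traj w >]}.

Definition path_of (R : realType) (w : W R) : R -> option Z2 := val w.
Coercion path_of : W >-> Funclass.

Section W_measurable.
Context (R : realType).

Definition W_generators : set_system (W R) :=
  [set E | exists (t : R) z, E = [set w : W R | w t = z]].

HB.instance Definition _ := Choice.on (W R).
HB.instance Definition _ := isPointed.Build (W R)
  (exist _ (fun=> None) (introT (asboolP _) is_traj_None)).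
HB.instance Definition _ := @isMeasurable.Build (sigma_display W_generators)
  (W R) <<s W_generators >>
  (@sigma_algebra0 _ setT W_generators) (@sigma_algebraC _ W_generators)
  (@sigma_algebra_bigcup _ setT W_generators).

Definition shift_rel : rel (W R) :=
  fun w w' => `[< exists s, forall t, w' t = w (t + s) >].

Lemma shift_rel_refl : reflexive shift_rel.
Proof. by move=> w; apply/asboolP; exists 0 => t; rewrite addr0. Qed.

Lemma shift_rel_sym : symmetric shift_rel.
Proof.
by move=> w w'; apply/asboolP/asboolP => -[s ws]; exists (- s) => t;
  rewrite ws subrK.
Qed.

Lemma shift_rel_trans : transitive shift_rel.
Proof.
move=> w2 w1 w3 /asboolP[s h1] /asboolP[s' h2]; apply/asboolP.
by exists (s' + s) => t; rewrite h2 h1 addrA.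
Qed.

Canonical shift_equiv :=
  EquivRel shift_rel shift_rel_refl shift_rel_sym shift_rel_trans.

Definition Wstar := {eq_quot shift_equiv}.

HB.instance Definition _ := Choice.on Wstar.
HB.instance Definition _ := EqQuotient.on Wstar.

Definition pi_star (w : W R) : Wstar := \pi_Wstar w.

HB.instance Definition _ := isPointed.Build Wstar (pi_star point).

Definition Wstar_measurable : set_system Wstar :=
  [set E | measurable (pi_star @^-1` E)].

Let Wstar0 : Wstar_measurable set0.
Proof. by rewrite /Wstar_measurable/= preimage_set0. Qed.

Let WstarC E : Wstar_measurable E -> Wstar_measurable (~` E).
Proof.
by rewrite /Wstar_measurable/= -preimage_setC => mE; exact: measurableC.
Qed.

Let Wstar_bigcup (F : (set Wstar)^nat) :
  (forall i, Wstar_measurable (F i)) -> Wstar_measurable (\bigcup_i F i).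
Proof.
rewrite /Wstar_measurable/= => mF; rewrite preimage_bigcup.
exact: bigcup_measurable.
Qed.

Definition Wstar_display : measure_display.
Proof. exact: default_measure_display. Qed.

HB.instance Definition _ := @isMeasurable.Build Wstar_display
  Wstar Wstar_measurable Wstar0 WstarC Wstar_bigcup.

End W_measurable.

Section interlacement.
Context {R : realType}.

Definition Wstar_visiting (A : set Z2) : set (Wstar R) :=
  @pi_star R @` [set w : W R | exists t x, A x /\ w t = Some x].

Section intensity.
Variables (S : srw R) (N : nat).
Local Notation P := (srw_law S).

Definition forward_path (o : S) : traj R := fun t =>
  if (t%:E < exit (eball R N) o)%E then Some (X t o) else None.

Definition Y (t : R) (o : S) : option Z2 :=
  if ((jump_time 1 o + t)%:E < exit (eball R N) o)%E
  then Some (X (jump_time 1 o + t) o) else None.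

(* The left limit of Y at - s, in the discrete space of values. *)
Definition backward_path (o : S) : traj R := fun s =>
  xget None [set z | \forall r \near (- s)^'-, Y r o = z].

Definition cond_prob (x : Z2) (E C : set S) : R :=
  fine (P x (E `&` C)) / fine (P x C).

Record is_Q (A : set Z2) (Q : {measure set (W R) -> \bar R}) : Prop := IsQ {
  Q_start : Q [set w : W R | ~ exists2 x, A x & w 0 = Some x] = 0%E;
  Q_law : forall x F G, A x ->
    coord_sigma [set t | 0 <= t] F -> coord_sigma [set s | s < 0] G ->
    Q [set w : W R | w 0 = Some x /\ F (path_of w) /\ G (path_of w)] =
    (fine (P x (avoid_after A N)) * fine (P x (avoid0 N))
     * cond_prob x [set o | F (forward_path o)] (avoid0 N)
     * cond_prob x [set o | G (backward_path o)] (avoid_after A N))%:E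
}.

Record is_nu (nu : {measure set (Wstar R) -> \bar R}) : Prop := IsNu {
  nu_supported : nu (~` Wstar_visiting (eball R N)) = 0%E;
  nu_restricted : forall A : set Z2, A 0 -> A `<=` eball R N ->
    exists2 Q : {measure set (W R) -> \bar R}, is_Q A Q &
      forall E, measurable E ->
        nu (E `&` Wstar_visiting A) = Q (@pi_star R @^-1` E)
}.

End intensity.

(* A point measure is presented by an enumeration [pts] of its atoms, in which
   an index i with [pts i = None] is unused. *)
Definition point_count (T : Type) (pts : nat -> option T) (B : set T) : \bar R :=
  (\sum_(0 <= i <oo) (if pts i is Some a then (\1_B a)%:E else 0))%E.

Record poisson_point_measure d (T : measurableType d) d' (O : measurableType d')
    (P : probability O R) (mu : set T -> \bar R) (pts : O -> nat -> option T) :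
    Prop := PoissonPointMeasure {
  ppm_measurable : forall B, measurable B ->
    measurable_fun setT (fun o => point_count (pts o) B);
  ppm_finite : forall B (m : R) (k : nat), measurable B -> mu B = m%:E ->
    P [set o | point_count (pts o) B = k%:R%:E] =
    (expR (- m) * m ^+ k / k`!%:R)%:E;
  ppm_infinite : forall B, measurable B -> mu B = +oo%E ->
    P [set o | point_count (pts o) B = +oo%E] = 1%E;
  ppm_independent : forall n (B : 'I_n -> set T) (C : 'I_n -> set (\bar R)),
    (forall i, measurable (B i)) -> (forall i, measurable (C i)) ->
    trivIset setT B ->
    P [set o | forall i, C i (point_count (pts o) (B i))] =
    (\prod_(i < n) P [set o | C i (point_count (pts o) (B i))])%E
}.

Definition interlacement_intensity (nu : {measure set (Wstar R) -> \bar R}) :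
    set (Wstar R * R) -> \bar R :=
  (nu \x mrestr lebesgue_measure (measurable_itv `[0%R, +oo[))%E.

Record interlacement_process d (O : measurableType d) (P : probability O R)
    (nu : {measure set (Wstar R) -> \bar R})
    (pts : O -> nat -> option (Wstar R * R)) : Prop := InterlacementProcess {
  level_ge0 : forall o i a, pts o i = Some a -> 0 <= a.2;
  interlacement_ppm :
    poisson_point_measure P (interlacement_intensity nu) pts
}.

Definition occupation_time (x : Z2) (w : W R) : \bar R :=
  (\int[lebesgue_measure]_t (\1_[set t | w t = Some x] t)%:E)%E.

Definition local_time (pts : nat -> option (Wstar R * R)) (x : Z2) (u : R) :
    \bar R :=
  (\sum_(0 <= i <oo)
     (if pts i is Some a then
        if (a.2 <= u)%R then occupation_time x (repr a.1) else 0
      else 0))%E.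

Definition interlacement_set (pts : nat -> option (Wstar R * R)) (u : R) :
    set Z2 :=
  [set x | (0 < local_time pts x u)%E].

End interlacement.

Definition config := Z2 -> bool.

Definition config_generators : set_system config :=
  [set E | exists x b, E = [set y : config | y x = b]].

HB.instance Definition _ := Pointed.on config.
HB.instance Definition _ :=
  @isMeasurable.Build (sigma_display config_generators) config
    <<s config_generators >> (@sigma_algebra0 _ setT config_generators)
    (@sigma_algebraC _ config_generators)
    (@sigma_algebra_bigcup _ setT config_generators).

Definition is_Qalpha (R : realType) (S : srw R) (alpha : R)
    (Q : probability config R) : Prop :=
  forall A : set Z2, finite_set A -> A 0 ->
    Q [set y : config | forall x, A x -> y x = false] =
    (expR (- (pi / 2%:R) * alpha * capacity S A))%:E.

(* Weak convergence of all finite-dimensional marginals: every function on the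
   finite discrete space {0,1}^n is a bounded continuous test function. *)
Definition fdd_weak_cvg (R : realType) (d : nat -> measure_display)
    (O : forall N, measurableType (d N)) (P : forall N, probability (O N) R)
    (xi : forall N, O N -> config) (Q : probability config R) : Prop :=
  forall n (x : 'I_n -> Z2) (f : {ffun 'I_n -> bool} -> R),
    (\int[P N]_o (f [ffun i => xi N o (x i)])%:E)%E @[N --> \oo] -->
    (\int[Q]_y (f [ffun i => y (x i)])%:E)%E.

(* Main.v *)
Require Import Defs.
From HB Require Import structures.
From mathcomp Require Import all_boot all_order all_algebra.
From mathcomp Require Import all_classical all_reals all_analysis.
From mathcomp Require Import measurable_realfun.
From mathcomp Require Import zify ring lra.
Set Implicit Arguments.
Unset Strict Implicit.
Unset Printing Implicit Defensive.
Import Order.TTheory GRing.Theory Num.Theory.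
Import numFieldNormedType.Exports.
Local Open Scope classical_set_scope.
Local Open Scope ring_scope.

(* The rotated coordinates of the planar walk are independent one-dimensional
   walks, so [p_(2m)] is an explicit product of central binomial weights.  With
   Wallis' bounds this gives the potential kernel [a]: it satisfies
   [avg a = a + 1_0], equals [(1/pi) ln (1 + |x|^2) + O(1)], and its increments
   vanish at infinity.

   By the maximum principle, a function [g] which vanishes on [A], is harmonic
   off [A] and is [(2/pi) ln |x| + O(1)] satisfies
   [ln N * P_y (T_(B_N) < H_A) --> (pi/2) g y].  For [A = {0}] take [g = a].
   For a general finite [A] containing 0 take
   [g y = c + \sum_(z in A) q z * a (y - z)] with [\sum q = 1].  Such a [g]
   exists because the symmetric matrix [a (z - z')], bordered by ones, is
   invertible: an element of its kernel is a bounded harmonic function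
   off [A] which vanishes on [A].  Solving the same system for the indicator of
   a point [x] of [A] represents [P_y (X at H_A is x)] by a combination of
   total weight 0, and the symmetry of the matrix identifies its limit
   at infinity, [hm_A x], with [q x], the mean of [g] around [x].

   Hence [nu (W*_A) = \sum_(x in A) P_x (H~_A > T_(B_N)) P_x (H_0 > T_(B_N))] is
   equivalent to [(pi/2)^2 cap A / ln^2 N], the probability [exp (- u_N nu (W*_A))]
   that [I^(u_N)] misses [A] converges to [exp (- (pi/2) alpha cap A)], and
   inclusion-exclusion gives all the finite-dimensional marginals. *)

(** * One-dimensional walk *)

Section one_dimensional_walk.
Context {R : realType}.
Implicit Types (k m : nat) (i j : int).

(** Law at time [k] of the simple walk on the integers started at 0, kept as a recursion valid at
    every integer rather than as a binomial coefficient with a parity condition. *)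
Fixpoint walk1 k j : R :=
  if k is k'.+1 then (walk1 k' (j - 1) + walk1 k' (j + 1)) / 2%:R
  else (j == 0)%:R.

Lemma walk1_ge0 k j : 0 <= walk1 k j.
Proof.
elim: k j => [|k IH] j /=; first exact: ler0n.
by rewrite divr_ge0 ?ler0n// addr_ge0.
Qed.

Lemma walk1N k j : walk1 k (- j) = walk1 k j.
Proof.
elim: k j => [|k IH] j /=; first by rewrite oppr_eq0.
by rewrite addrC -opprD IH -(IH (j - 1)) opprB (addrC 1).
Qed.

(** Ratio of consecutive binomial coefficients, in multiplied form so that it also makes sense where
    the weights vanish. The case [k + 1] follows linearly from the instances at [j - 1] and
    [j + 1]. *)
Lemma walk1_ratio k j :
  walk1 k (j + 2) * (k%:R + j%:~R + 2%:R) = walk1 k j * (k%:R - j%:~R).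
Proof.
elim: k j => [|k IH] j.
  rewrite /= add0r sub0r; case: eqP => [jE|_].
    have -> : j = - 2 by lia.
    by rewrite /= mul0r; lra.
  by case: eqP => [->|_]; rewrite !(mul0r, mulr0, mul1r)// mulr0z oppr0.
rewrite /=; have /= := IH (j + 1); have /= := IH (j - 1).
have -> : j - 1 + 2 = j + 1 by ring.
have -> : j + 2 - 1 = j + 1 by ring.
have -> : j + 1 + 2 = j + 2 + 1 by ring.
rewrite !rmorphD !rmorphN /= ?mulr1z ?rmorph1 -(natr1 k); move: (j%:~R : R) (k%:R : R) => J K.
move: (walk1 _ _) (walk1 _ _) (walk1 _ _) => b2 b0 b1 H1 H2.
by lra.
Qed.

Lemma walk1_parity k j : odd (k + `|j|) -> walk1 k j = 0.
Proof.
elim: k j => [|k IH] j /=.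
  by rewrite add0n => jo; case: eqP => [j0|//]; rewrite j0 in jo.
by move=> kj; rewrite !IH ?addr0 ?mul0r//; lia.
Qed.

Lemma walk1_gt k j : (k < `|j|)%N -> walk1 k j = 0.
Proof.
elim: k j => [|k IH] j /=; first by case: eqP => // ->.
by move=> kj; rewrite !IH ?addr0 ?mul0r//; lia.
Qed.

(** Doubling both time and site removes the parity obstruction. The value [wallis m] at 0 is the
    return probability at time [2 m], the central binomial weight. *)
Definition ewalk m j : R := walk1 m.*2 (j *+ 2).
Definition wallis m : R := ewalk m 0.

Lemma sqr_intr_abs j : (j%:~R : R) ^+ 2 = (`|j|%N%:R) ^+ 2.
Proof. by rewrite pmulrn abszE intr_norm real_normK// num_real. Qed.

Lemma ewalk_ge0 m j : 0 <= ewalk m j.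
Proof. exact: walk1_ge0. Qed.

Lemma ewalkN m j : ewalk m (- j) = ewalk m j.
Proof. by rewrite /ewalk mulNrn walk1N. Qed.

Lemma ewalk_abs m j : ewalk m j = ewalk m `|j|%N.
Proof.
have [jE|jE] : j = `|j|%N \/ j = - (`|j|%N : int) by lia.
  by rewrite {1}jE.
by rewrite {1}jE ewalkN.
Qed.

Lemma ewalk_gt m j : (m < `|j|)%N -> ewalk m j = 0.
Proof. by move=> mj; rewrite /ewalk walk1_gt//; lia. Qed.

Lemma ewalk_ratio m (j : nat) :
  ewalk m j.+1 * (m%:R + j%:R + 1) = ewalk m j * (m%:R - j%:R).
Proof.
have := walk1_ratio m.*2 ((j : int) *+ 2).
rewrite /ewalk; have -> : (j : int) *+ 2 + 2 = (j.+1 : int) *+ 2 by lia.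
rewrite rmorphMn /= -!muln2 natrM pmulrn.
by move=> H; apply: (@mulIf _ 2%:R) => //; lra.
Qed.

Lemma wallis_ge0 m : 0 <= wallis m. Proof. exact: ewalk_ge0. Qed.

Lemma wallis0 : wallis 0 = 1. Proof. by []. Qed.

(** Two steps back from 0 lead to the sites -2, 0 and 2; [walk1_ratio] at 0 expresses the outer two
    weights by the central one. *)
Lemma wallisS m : wallis m.+1 * (m.*2.+2)%:R = wallis m * (m.*2.+1)%:R.
Proof.
have := walk1_ratio m.*2 0.
rewrite /wallis /ewalk mul0rn doubleS [walk1 m.*2.+2 0]/=.
have -> : walk1 m.*2 (0 - 1 - 1) = walk1 m.*2 (0 + 2) by rewrite -walk1N; congr walk1.
have -> : 0 - 1 + 1 = 0 :> int by [].
have -> : 0 + 1 - 1 = 0 :> int by [].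
have -> : 0 + 1 + 1 = 0 + 2 :> int by [].
rewrite mulr0z -(natr1 m.*2.+1) -(natr1 m.*2).
move: (walk1 _ _) (walk1 _ _) (_%:R : R) => x y z H.
by lra.
Qed.

(** Rational substitute for Gaussian decay. The induction on the absolute value of [j] rests on [(m
    - j) (m + (j + 1)^2) <= (m + j^2) (m + j + 1)], where the difference is
    [j (j + 1) (2 j + 1)]. *)
Lemma ewalk_upper m j : ewalk m j * (m%:R + j%:~R ^+ 2) <= wallis m * m%:R.
Proof.
rewrite ewalk_abs sqr_intr_abs; move: `|j|%N => {}j.
elim: j => [|j IH]; first by rewrite expr0n addr0.
have := ewalk_ratio m j; have := ewalk_ge0 m j; have := ewalk_ge0 m j.+1.
have := wallis_ge0 m.
have m0 : 0 <= m%:R :> R by [].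
have j0 : 0 <= j%:R :> R by [].
rewrite -natr1; move: IH m0 j0; move: (ewalk m j.+1) (ewalk m j) (wallis m) (m%:R : R) (j%:R : R).
move=> c1 c b M J IH M0 J0 b0 c10 c0 H.
have D : 0 < M + J + 1 by lra.
rewrite -(ler_pM2r D).
have -> : c1 * (M + (J + 1) ^+ 2) * (M + J + 1) =
    c * (M - J) * (M + (J + 1) ^+ 2) by rewrite -H; ring.
have : (c * (M + J ^+2)) * (M + J + 1) <= b * M * (M + J + 1) by rewrite ler_pM2r.
have : 0 <= c * (J * (J + 1) * (2 * J + 1)) by rewrite !mulr_ge0//; lra.
nra.
Qed.

Lemma ewalk_lower m j : wallis m * (m%:R - j%:~R ^+ 2) <= ewalk m j * m%:R.
Proof.
rewrite ewalk_abs sqr_intr_abs; move: `|j|%N => {}j.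
elim: j => [|j IH]; first by rewrite expr0n subr0.
have := ewalk_ratio m j; have := ewalk_ge0 m j; have := ewalk_ge0 m j.+1.
have := wallis_ge0 m.
have m0 : 0 <= m%:R :> R by [].
have j0 : 0 <= j%:R :> R by [].
rewrite -natr1; move: IH m0 j0.
(* The induction hypothesis gets multiplied by [m - j], which needs [j <= m]; for larger [j] the
   left-hand side is already nonpositive. *)
have [jm|mj] := leqP j m; last first.
  have mj' : (m%:R + 1 <= j%:R :> R) by rewrite natr1 ler_nat.
  move: mj'; move: (ewalk m j.+1) (ewalk m j) (wallis m) (m%:R : R) (j%:R : R).
  move=> c1 c b M J JM IH M0 J0 b0 c10 c0 H.
  apply: (@le_trans _ _ 0); last by rewrite mulr_ge0.
  by rewrite mulr_ge0_le0//; nra.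
have : (j%:R <= m%:R :> R) by rewrite ler_nat.
move: (ewalk m j.+1) (ewalk m j) (wallis m) (m%:R : R) (j%:R : R) => c1 c b M J JM IH M0 J0 b0 c10 c0 H.
have D : 0 < M + J + 1 by lra.
rewrite -(ler_pM2r D); have -> : c1 * M * (M + J + 1) = (c * M) * (M - J) by rewrite mulrAC H; ring.
have : (b * (M - J ^+ 2)) * (M - J) <= (c * M) * (M - J) by rewrite ler_wpM2r//; lra.
have : 0 <= b * (J ^+ 3 + (J + 1) ^+ 3) by rewrite mulr_ge0// addr_ge0// exprn_ge0//; lra.
lra.
Qed.

Lemma ewalk_le m j : ewalk m j <= wallis m.
Proof.
case: m => [|m].
  by rewrite wallis0 /ewalk/=; case: eqP.
have := ewalk_upper m.+1 j.
have m0 : 0 < m.+1%:R :> R by [].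
have j0 : 0 <= j%:~R ^+ 2 :> R by rewrite sqr_ge0.
move=> H; rewrite -(ler_pM2r m0); apply: le_trans H.
by rewrite ler_wpM2l ?ewalk_ge0// lerDl.
Qed.

(* AM-GM: [2 j sqrt m <= m + j^2]. *)
Lemma ewalk_diff m j : (0 < m)%N ->
  `|ewalk m (j + 1) - ewalk m j| * Num.sqrt m%:R <= 3%:R * wallis m.
Proof.
move=> m_gt0.
have key (n : nat) : `|ewalk m n.+1 - ewalk m n| * Num.sqrt m%:R <= 3%:R * wallis m.
  have := ewalk_upper m n; have := ewalk_ratio m n; rewrite -pmulrn.
  have := ewalk_ge0 m n; have := wallis_ge0 m.
  have m1 : 1 <= m%:R :> R by rewrite ler1n.
  have n0 : 0 <= n%:R :> R by [].
  have s1 : 1 <= Num.sqrt m%:R :> R by rewrite -{1}[1 : R]sqrtr1 ler_sqrt// ltr0n.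
  have sE : Num.sqrt m%:R ^+ 2 = m%:R :> R by rewrite sqr_sqrtr.
  move: (Num.sqrt _) s1 sE => s s1 sE; rewrite -sE.
  move: (ewalk m n.+1) (ewalk m n) (wallis m) (n%:R : R) n0 => c1 c b J J0 b0 c0 H1 H2.
  have D : 0 < s ^+ 2 + J + 1 by nra.
  have E : (c - c1) * (s ^+ 2 + J + 1) = c * (2 * J + 1) by rewrite mulrBl H1; ring.
  have le : 0 <= c - c1.
    by rewrite -(pmulr_lge0 _ D) E mulr_ge0//; lra.
  rewrite distrC ger0_norm// -(ler_pM2r D) mulrAC E.
  have h1 : c * (s ^+ 2 + J ^+ 2) * 3 <= 3 * b * (s ^+ 2 + J + 1).
    have : 0 <= b * (J + 1) by rewrite mulr_ge0//; lra.
    lra.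
  apply: le_trans h1; rewrite -!mulrA ler_wpM2l//.
  have : 0 <= (s - J) ^+ 2 by rewrite sqr_ge0.
  nra.
(* For negative [j], reflection exchanges the roles of [j] and [j + 1]. *)
have [jE|jE] : j = `|j|%N \/ j = - ((absz (j + 1)).+1 : int) by lia.
  rewrite jE; have -> : (`|j|%N : int) + 1 = `|j|.+1 by lia.
  exact: key.
have -> : j + 1 = - (absz (j + 1) : int) by lia.
by rewrite {2}jE !ewalkN distrC; exact: key.
Qed.

End one_dimensional_walk.

(** * Wallis bounds *)

Section wallis_product.
Context {R : realType}.
Implicit Types (n m : nat) (x : R).

(** Antiderivative of [cos ^ n] vanishing at 0, written through the reduction formula. Its value
    [V n] at [pi / 2] is the Wallis integral, obtained here without integration theory. *)
Fixpoint cosX_prim n x : R :=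
  match n with
  | 0 => x
  | 1 => sin x
  | n'.+2 => cos x ^+ n'.+1 * sin x / n%:R + n'.+1%:R / n%:R * cosX_prim n' x
  end.

Lemma is_derive_cosX_prim n x : is_derive x 1 (cosX_prim n) (cos x ^+ n).
Proof.
suff [] : is_derive x 1 (cosX_prim n) (cos x ^+ n) /\
  is_derive x 1 (cosX_prim n.+1) (cos x ^+ n.+1) by [].
elim: n => [|n [IH IH1]]; first by split; [exact: is_derive_id|exact: is_derive_sin].
split=> //.
have n2 : n.+2%:R != 0 :> R by [].
have -> : cosX_prim n.+2 = (n.+2%:R)^-1 \*: (cos ^+ n.+1 * sin) +
    (n.+1%:R / n.+2%:R) \*: cosX_prim n.
  by apply/funext => y; rewrite !fctE /= [in RHS]/GRing.scale /= [in RHS]mulrC.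
apply: is_derive_eq.
rewrite !fctE /= /GRing.scale /= !exprS.
have := cos2Dsin2 x; rewrite -!(natr1 n.+1) -!(natr1 n).
have : n%:R + 1 + 1 != 0 :> R by rewrite !natr1.
move: (cos x) (sin x) (cos x ^+ n) (n%:R : R) => c s cn K K0 E.
have {E} E : s ^+2 = 1 - c ^+ 2 by lra.
have -> : s * ((K + 1) * cn * - s) = - (K + 1) * cn * s ^+ 2 by ring.
by rewrite E; field.
Qed.

Lemma cosX_prim0 n : cosX_prim n 0 = 0.
Proof.
suff [] : cosX_prim n 0 = 0 /\ cosX_prim n.+1 0 = 0 by [].
elim: n => [|n [IH IH1]]; first by split; rewrite //= sin0.
by split=> //=; rewrite sin0 IH !(mulr0, mul0r) addr0.
Qed.

Let V n : R := cosX_prim n (pi / 2%:R).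

Let V_le n : V n.+1 <= V n.
Proof.
have pi0 : 0 <= pi / 2%:R :> R by rewrite divr_ge0 ?pi_ge0.
pose f x := cosX_prim n x - cosX_prim n.+1 x.
have fD x : is_derive x 1 f (cos x ^+ n - cos x ^+ n.+1).
  by apply: is_deriveB; exact: is_derive_cosX_prim.
suff : f 0 <= f (pi / 2%:R) by rewrite /f !cosX_prim0 subr0 subr_ge0.
apply: (@ger0_derive1_ndecr _ f 0 (pi / 2%:R)) => //.
- move=> x; rewrite in_itv/= => /andP[x0 x1]; rewrite derive1E derive_val.
  have c0 : 0 <= cos x by apply: cos_ge0_pihalf; lra.
  by rewrite subr_ge0 exprS ler_piMl ?exprn_ge0// cos_le1.
- by apply: derivable_within_continuous => x _.
Qed.

Let VSS n : V n.+2 * n.+2%:R = V n * n.+1%:R.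
Proof.
have n2 : n.+2%:R != 0 :> R by [].
by rewrite /V /= cos_pihalf exprS !mul0r add0r; field.
Qed.

Let V_even m : V m.*2 = wallis m * (pi / 2%:R).
Proof.
elim: m => [|m IH]; first by rewrite wallis0 mul1r.
have h : m.*2.+2%:R != 0 :> R by [].
apply: (mulIf h); by rewrite doubleS VSS IH [LHS]mulrAC -(@wallisS R); ring.
Qed.

Let V_odd m : V m.*2.+1 * (m.*2.+1)%:R * wallis m = 1.
Proof.
elim: m => [|m IH]; first by rewrite wallis0 !mulr1 /V /= sin_pihalf.
by rewrite doubleS VSS -[RHS]IH mulrAC -(mulrA _ (wallis _)) (@wallisS R); ring.
Qed.

Lemma wallis_gt0 m : 0 < wallis m :> R.
Proof.
rewrite lt_neqAle wallis_ge0 andbT eq_sym; apply/eqP => w0.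
by have /eqP := V_odd m; rewrite w0 mulr0 eq_sym oner_eq0.
Qed.

(** This is [V (2 m + 1) <= V (2 m)], both integrals being expressed through [wallis m]. *)
Lemma wallis_sqr_ge m : 2%:R / pi / (m.*2.+1)%:R <= wallis m ^+ 2 :> R.
Proof.
have := V_le m.*2; rewrite V_even => H.
have p0 : 0 < pi :> R by exact: pi_gt0.
have := V_odd m; have := wallis_gt0 m.
have n0 : 0 < m.*2.+1%:R :> R by [].
move: (wallis m) (V _) H n0 => w v H n0 w0 E.
rewrite ler_pdivrMr// ler_pdivrMr// mulrAC.
have : v * (m.*2.+1%:R * w) <= w * (pi / 2) * (m.*2.+1%:R * w).
  by rewrite ler_wpM2r// mulr_ge0// ltW.
by rewrite [v * _]mulrA E; lra.
Qed.

(** This is [V (2 m) <= V (2 m - 1)], hence the shift of [m] by one at the start. *)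
Lemma wallis_sqr_le m : (0 < m)%N -> wallis m ^+ 2 <= (pi * m%:R)^-1 :> R.
Proof.
case: m => // m _.
have := V_le m.*2.+1; rewrite -doubleS V_even => H.
have p0 : 0 < pi :> R by exact: pi_gt0.
have := V_odd m; have := wallis_gt0 m; have := @wallisS R m.
have n0 : 0 < m.*2.+1%:R :> R by [].
have := wallis_gt0 m.+1.
move: (wallis m) (wallis m.+1) (V _) H n0 => w w1 v H n0 w10 Ew w0 E.
rewrite -[leRHS]div1r ler_pdivlMr ?mulr_gt0//.
have : w1 * (pi / 2) * (m.*2.+1%:R * w) <= v * (m.*2.+1%:R * w).
  by rewrite ler_wpM2r// mulr_ge0// ltW.
rewrite [v * _]mulrA E.
have -> : w1 * (pi / 2) * (m.*2.+1%:R * w) = w1 * (pi / 2) * (w1 * m.*2.+2%:R) by rewrite Ew; ring.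
by rewrite -doubleS -muln2 natrM; lra.
Qed.

Lemma wallis_sqr_le1 m : (0 < m)%N -> wallis m ^+ 2 <= m%:R^-1 :> R.
Proof.
move=> m0; apply: le_trans (wallis_sqr_le m0) _.
have p2 : 2 <= pi :> R by exact: pi_ge2.
rewrite lef_pV2 ?posrE ?mulr_gt0 ?ltr0n ?pi_gt0//.
by rewrite ler_peMl//; lra.
Qed.

Lemma wallis_sqr_ge_inv m : (pi * m.+1%:R)^-1 <= wallis m ^+ 2 :> R.
Proof.
apply: le_trans (wallis_sqr_ge m).
have p0 : 0 < pi :> R by exact: pi_gt0.
rewrite invfM mulrAC [leRHS]mulrC ler_pM2l ?invr_gt0//.
rewrite ler_pdivlMr// mulrC ler_pdivrMr// -natrM ler_nat; lia.
Qed.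

(** Each term is at least [1 / (pi (m + 1))], and [ln (1 + t) <= t] with [t = 1 / (m + 1)] makes the
    logarithms telescope. *)
Lemma sum_wallis_sqr_ge n :
  ln n.+1%:R / pi <= \sum_(m < n) wallis m ^+ 2 :> R.
Proof.
have p0 : 0 < pi :> R by exact: pi_gt0.
elim: n => [|n IH]; first by rewrite big_ord0 ln1 mul0r.
rewrite big_ord_recr /=.
have -> : n.+2%:R = n.+1%:R * (1 + n.+1%:R^-1) :> R.
  by rewrite mulrDr mulr1 mulfV// natr1.
rewrite lnM ?posrE ?addr_gt0 ?invr_gt0// mulrDl lerD//.
apply: le_trans (wallis_sqr_ge_inv n).
rewrite ler_pdivrMr// invfM mulrAC mulVf ?gt_eqF// mul1r.
by apply: le_ln1Dx; apply: (@lt_trans _ _ 0); rewrite ?invr_gt0//; lra.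
Qed.

(** The constant 2 pays for the terms [m = 0] and [m = 1]; for the later ones [ln (1 - t) <= - t]
    gives the telescoping comparison. *)
Lemma sum_wallis_sqr_le n :
  \sum_(m < n.+2) wallis m ^+ 2 <= 2%:R + ln n.+1%:R / pi :> R.
Proof.
have p0 : 0 < pi :> R by exact: pi_gt0.
elim: n => [|n IH].
  rewrite !big_ord_recr big_ord0 /= add0r wallis0 ln1 mul0r addr0.
  have := @wallis_sqr_le1 1 isT; rewrite invr1; lra.
rewrite big_ord_recr /=; apply: le_trans (lerD IH (wallis_sqr_le (ltn0Sn _))) _.
rewrite -addrA lerD2l invfM -lerBrDl -mulrBl mulrC ler_pM2r ?invr_gt0//.
have -> : ln n.+1%:R = ln (n.+2%:R) + ln (1 + (- n.+2%:R^-1)) :> R.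
  rewrite -lnM ?posrE ?subr_gt0 ?invf_lt1 ?ltr1n//.
  by rewrite mulrDr mulr1 mulrN mulfV// -[n.+2%:R](natr1 n.+1) addrK.
have := @le_ln1Dx R (- n.+2%:R^-1).
rewrite ltrN2 invf_lt1 ?ltr1n// => /(_ isT).
by rewrite opprD addrA subrr add0r lerNr.
Qed.

End wallis_product.

(** * The planar walk as two independent one-dimensional walks *)

Section step_sum.
Context {R : realType}.
Implicit Types (f : Z2 -> R) (x : Z2) (k n m : nat) (i j : int).
Local Notation p := (@step_sum_prob R).

Definition avg f x : R := (\sum_(i < 4) f (x + step i)) / 4%:R.

Lemma avgE f x : avg f x = (f (x + (1, 0)) + f (x + (-1, 0)) +
  f (x + (0, 1)) + f (x + (0, -1))) / 4%:R.
Proof. by rewrite /avg !big_ord_recl big_ord0 addr0 /= !addrA. Qed.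

Lemma avg_sub_step f x : (\sum_(i < 4) f (x - step i)) / 4%:R = avg f x.
Proof.
rewrite avgE !big_ord_recl big_ord0 addr0 /step /= !addrA; congr (_ / _).
have -> : - ((1, 0) : Z2) = (-1, 0) by [].
have -> : - ((-1, 0) : Z2) = (1, 0) by [].
have -> : - ((0, 1) : Z2) = (0, -1) by [].
have -> : - ((0, -1) : Z2) = (0, 1) by [].
by ring.
Qed.

Lemma step_sum_prob0 x : p 0 x = (x == 0)%:R.
Proof.
rewrite /step_sum_prob expr0 divr1; congr (_%:R).
case: eqP => [->|x0].
  rewrite (_ : finset _ = [set: 0.-tuple 'I_4]%SET) ?cardsT ?card_tuple//.
  by apply/setP => s; rewrite !inE big_ord0 eqxx.
by apply/eqP; rewrite cards_eq0; apply/eqP/setP => s; rewrite !inE big_ord0; apply/eqP => /esym.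
Qed.

(** First-step decomposition: [F] identifies a tuple of [k + 1] steps with its head and its tail,
    and the symmetry of the steps turns [x - step i] into [x + step i]. *)
Lemma step_sum_probS k x : p k.+1 x = avg (p k) x.
Proof.
rewrite -avg_sub_step /step_sum_prob -mulr_suml exprSr invfM mulrA; congr (_ / _ / _).
rewrite -natr_sum; congr (_%:R).
pose F (q : 'I_4 * k.-tuple 'I_4) : k.+1.-tuple 'I_4 := cons_tuple q.1 q.2.
have Fbij : bijective F.
  exists (fun t => (thead t, behead_tuple t)) => [[i t]|t].
    by rewrite /F theadE; congr pair; apply: val_inj.
  by rewrite [RHS]tuple_eta; apply: val_inj.
under eq_bigr do rewrite -sum1_card big_mkcond /=.
rewrite -sum1_card big_mkcond /= (reindex F) /=; last exact: onW_bij.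
rewrite -(pair_bigA _ (fun (i : 'I_4) t => if F (i, t) \in _ then 1%N else 0%N)) /=.
apply: eq_bigr => i _; apply: eq_bigr => t _; rewrite !inE big_ord_recl.
have -> : \sum_(j < k) step (tnth (F (i, t)) (lift ord0 j)) = \sum_(j < k) step (tnth t j).
  by apply: eq_bigr => j _; rewrite /F tnthS.
by rewrite /F tnth0 [in RHS]eq_sym subr_eq [in RHS]eq_sym [in RHS]addrC.
Qed.

(** A step changes each of [x1 + x2] and [x1 - x2] by 1 in absolute value, and the four steps
    realize the four pairs of signs, so the recursion factorizes. *)
Lemma step_sum_probE k x : p k x = walk1 k (x.1 + x.2) * walk1 k (x.1 - x.2).
Proof.
elim: k x => [|k IH] x.
  rewrite step_sum_prob0 /= -natrM mulnb; congr (_%:R).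
  case: x => a b /=; have -> : ((a, b) == 0 :> Z2) = (a == 0) && (b == 0) by [].
  by lia.
rewrite step_sum_probS avgE !IH /=; case: x => a b /=.
have -> : a + 1 + (b + 0) = a + b + 1 by ring.
have -> : a + 1 - (b + 0) = a - b + 1 by ring.
have -> : a + - 1 + (b + 0) = a + b - 1 by ring.
have -> : a + - 1 - (b + 0) = a - b - 1 by ring.
have -> : a + 0 + (b + 1) = a + b + 1 by ring.
have -> : a + 0 - (b + 1) = a - b - 1 by ring.
have -> : a + 0 + (b + - 1) = a + b - 1 by ring.
have -> : a + 0 - (b + - 1) = a - b + 1 by ring.
by field.
Qed.

Lemma step_sum_probN k x : p k (- x) = p k x.
Proof.
rewrite !step_sum_probE /= -walk1N opprD !opprK; congr (_ * _).
by rewrite -walk1N opprD !opprK.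
Qed.

(* The sites [diag i j] are the even ones: [x1 + x2 = 2 i], [x1 - x2 = 2 j]. *)
Definition diag i j : Z2 := (i + j, i - j).

Lemma step_sum_prob_even m i j : p m.*2 (diag i j) = ewalk m i * ewalk m j.
Proof.
rewrite step_sum_probE /ewalk /=; congr (walk1 _ _ * walk1 _ _); rewrite mulr2n; ring.
Qed.

Lemma step_sum_prob_odd m i j : p m.*2.+1 (diag i j) = 0.
Proof.
rewrite step_sum_probE walk1_parity ?mul0r//=.
have -> : i + j + (i - j) = i *+ 2 by rewrite mulr2n; ring.
by lia.
Qed.

Lemma walk1_le k j : walk1 k j <= wallis k./2 :> R.
Proof.
have even m i : walk1 m.*2 i <= wallis m :> R.
  have [i_odd|i_even] := boolP (odd `|i|).
    by rewrite walk1_parity ?wallis_ge0//; lia.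
  have -> : i = (i %/ 2)%Z *+ 2 by rewrite mulr2n; lia.
  exact: ewalk_le.
have [k_odd|k_even] := boolP (odd k).
  have -> : k = k./2.*2.+1 by lia.
  rewrite /= uphalf_double ler_pdivrMr// mulr_natr mulr2n.
  by rewrite lerD.
by have {1}-> : k = k./2.*2 by lia.
Qed.

Lemma step_sum_prob_le k x : (1 < k)%N -> p k x <= (k./2)%:R^-1.
Proof.
move=> k1; apply: le_trans (wallis_sqr_le1 _); last by lia.
by rewrite step_sum_probE expr2 ler_pM ?walk1_ge0 ?walk1_le.
Qed.

Lemma cvg_half : n./2 @[n --> \oo] --> \oo.
Proof.
by move=> A [N _ NA]; exists N.*2 => // n /= Nn; apply: NA => /=; lia.
Qed.

Lemma step_sum_prob_cvg0 x : p n x @[n --> \oo] --> (0 : R).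
Proof.
apply: (@squeeze_cvgr _ _ _ _ (fun=> 0) (fun n => (n./2)%:R^-1)).
- exists 2%N => // n /= n1; rewrite step_sum_prob_le// andbT.
  by rewrite step_sum_probE mulr_ge0// walk1_ge0.
- exact: cvg_cst.
- have inv0 : (n%:R : R)^-1 @[n --> \oo] --> (0 : R).
    by rewrite -cvg_shiftS; exact: cvg_harmonic.
  exact: cvg_comp cvg_half inv0.
Qed.

End step_sum.

(** * Partial sums of the potential kernel at even sites *)

Section even_partial_sums.
Context {R : realType}.
Implicit Types (x : Z2) (k n m : nat) (i j : int).
Local Notation p := (@step_sum_prob R).

Definition kernel_sum n x : R := \sum_(k < n.+1) (p k 0 - p k x).
(** The partial sum of the kernel at [diag i j], reduced to even times since odd times contribute 0
    both there and at the origin. *)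
Definition even_sum n i j : R :=
  \sum_(m < n.+1) (wallis m ^+ 2 - ewalk m i * ewalk m j).

(** Shifting the summation index by one step of the walk; this is the finite-time form of
    [avg a = a + 1_0]. *)
Lemma kernel_sumS n x :
  kernel_sum n.+1 x = avg (kernel_sum n) x + p n.+1 0 - p 0 x.
Proof.
have -> : avg (kernel_sum n) x = \sum_(k < n.+1) p k 0 - \sum_(k < n.+1) avg (p k) x.
  rewrite /avg /kernel_sum -mulr_suml; under eq_bigr do rewrite sumrB.
  rewrite sumrB sumr_const card_ord -[_ *+ 4]mulr_natr.
  by rewrite exchange_big /=; field.
rewrite /kernel_sum sumrB big_ord_recr /= [X in _ - X]big_ord_recl /=.
under [X in _ - (_ + X)]eq_bigr do rewrite /bump /= add1n step_sum_probS.
by ring.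
Qed.

Lemma kernel_sum_diag n i j : kernel_sum n (diag i j) = even_sum n./2 i j.
Proof.
have zE : (0 : Z2) = diag 0 0 by [].
have even m : kernel_sum m.*2 (diag i j) = even_sum m i j.
  elim: m => [|m IH].
    rewrite /kernel_sum /even_sum !big_ord1 zE.
    by congr (_ - _); exact: (@step_sum_prob_even _ 0).
  rewrite /even_sum big_ord_recr /= -/(even_sum m i j) -IH.
  rewrite /kernel_sum doubleS 2!big_ord_recr /= -!doubleS zE.
  by rewrite !step_sum_prob_even !step_sum_prob_odd subr0 addr0.
have [n_odd|n_even] := boolP (odd n).
  have -> : n = n./2.*2.+1 by lia.
  rewrite /kernel_sum big_ord_recr /= -/(kernel_sum _ _) even zE.
  by rewrite !step_sum_prob_odd subr0 addr0 uphalf_double.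
by have {1}-> : n = n./2.*2 by lia.
Qed.

Let term_ge0 m i j : 0 <= wallis m ^+ 2 - ewalk m i * ewalk m j :> R.
Proof. by rewrite subr_ge0 expr2 ler_pM ?ewalk_ge0 ?ewalk_le. Qed.

Lemma even_sum_nd i j : {homo (fun n => even_sum n i j) : n m / (n <= m)%N >-> n <= m}.
Proof.
move=> n m nm; rewrite -(subnKC nm); elim: (m - n)%N => [|l IH].
  by rewrite addn0.
by rewrite addnS {2}/even_sum big_ord_recr /= (le_trans IH)// lerDl term_ge0.
Qed.

(** Half the squared norm of [diag i j]; the partial sums grow logarithmically up to this index and
    are nearly constant after it. *)
Let M i j : nat := (`|i| ^ 2 + `|j| ^ 2)%N.

(** Applying [ewalk_lower] to one coordinate after the other loses at most
    [wallis m ^ 2 * (i^2 + j^2) / m], and [wallis m ^ 2 <= 1 / m]. *)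
Let term_le m i j : (0 < m)%N ->
  wallis m ^+ 2 - ewalk m i * ewalk m j <= (M i j)%:R / m%:R ^+ 2 :> R.
Proof.
move=> m0.
have mR : 0 < m%:R :> R by rewrite ltr0n.
have Mge : 0 <= (M i j)%:R :> R by [].
suff : (wallis m ^+ 2 - ewalk m i * ewalk m j) * m%:R <= wallis m ^+ 2 * (M i j)%:R :> R.
  move=> H; rewrite ler_pdivlMr ?exprn_gt0// expr2 mulrA.
  have := ler_wpM2r (ltW mR) H; move/le_trans; apply.
  have := wallis_sqr_le1 m0 (R := R).
  by rewrite -div1r ler_pdivlMr// => W; rewrite mulrAC ler_piMl.
have := ewalk_lower m i (R := R); have := ewalk_lower m j (R := R).
have := ewalk_ge0 m i (R := R); have := ewalk_ge0 m j (R := R).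
have := ewalk_le m i (R := R); have := ewalk_le m j (R := R).
rewrite !sqr_intr_abs /M natrD !natrX.
move: (ewalk m i) (ewalk m j) (wallis m) => c d b.
have := sqr_ge0 (`|i|%N%:R : R); have := sqr_ge0 (`|j|%N%:R : R).
move: (_ ^+ 2 : R) (_ ^+ 2 : R) => I J J0 I0 db cb d0 c0 Hj Hi.
rewrite mulrBl lerBlDr.
have h1 : (b * (m%:R - I)) * b <= (c * m%:R) * b by rewrite ler_wpM2r//; lra.
have h2 : (b * (m%:R - J)) * c <= (d * m%:R) * c by rewrite ler_wpM2r//.
have h3 : J * (b * c) <= J * (b * b) by rewrite ler_wpM2l// ler_wpM2l//; lra.
lra.
Qed.

(** Up to index [M i j] the terms are bounded by [wallis m ^ 2], which costs 2 plus the logarithm.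
    Beyond, the bound [M i j / m ^ 2] telescopes to a total of at most 1. *)
Lemma even_sum_le n i j : (0 < M i j)%N ->
  even_sum n i j <= 3%:R + ln (M i j)%:R / pi.
Proof.
move=> M0; set N := M i j.
have tail l : even_sum (N + l) i j <= 3%:R + ln N%:R / pi - N%:R / (N + l)%:R.
  elim: l => [|l IH].
    rewrite addn0 divff ?pnatr_eq0 ?gtn_eqF//.
    have := sum_wallis_sqr_le N.-1 (R := R); rewrite prednK// => H.
    suff : even_sum N i j <= \sum_(m < N.+1) wallis m ^+ 2 by lra.
    by apply: ler_sum => m _; rewrite gerBl mulr_ge0 ?ewalk_ge0.
  rewrite addnS /even_sum big_ord_recr /= -/(even_sum _ _ _).
  apply: le_trans (lerD IH (term_le _ _ _)) _ => //.
  have : 0 < (N + l)%:R :> R by rewrite ltr0n; lia.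
  rewrite -/N -(natr1 (N + l)); move: (N%:R : R) (ler0n R N) => a a0.
  move: ((N + l)%:R) => t t0.
  suff : a / (t + 1) ^+ 2 <= a / t - a / (t + 1) by lra.
  have -> : a / t - a / (t + 1) = a / (t * (t + 1)) by field; lra.
  by rewrite ler_wpM2l// lef_pV2 ?posrE ?exprn_gt0 ?mulr_gt0//; nra.
have [nN|Nn] := leqP n N.
  apply: le_trans (even_sum_nd i j (leq_trans nN (leq_addr 0 N))) _.
  by apply: le_trans (tail _) _; rewrite gerBl divr_ge0.
by rewrite -(subnKC (ltnW Nn)); apply: le_trans (tail _) _; rewrite gerBl divr_ge0.
Qed.

(** Only the larger coordinate is estimated by [ewalk_upper]; the other factor is at most
    [wallis m], and [m * wallis m ^ 2 <= 1]. *)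
Lemma ewalk_prod_le m i j : (0 < m)%N -> (0 < M i j)%N ->
  ewalk m i * ewalk m j <= 2%:R / (M i j)%:R :> R.
Proof.
move=> m0 M0.
wlog ij : i j M0 / (`|j| <= `|i|)%N.
  move=> H; have [|/ltnW] := leqP `|j| `|i|; first exact: H.
  by rewrite [leLHS]mulrC /M addnC; apply: H; rewrite /M addnC.
have ci := ewalk_upper m i (R := R).
have W := wallis_sqr_le1 m0 (R := R).
have cj := ewalk_le m j (R := R).
have mR : 0 < m%:R :> R by rewrite ltr0n.
rewrite ler_pdivlMr ?ltr0n// /M natrD.
have : (`|j| ^ 2)%:R <= (`|i| ^ 2)%:R :> R by rewrite ler_nat leq_exp2r.
move: ci W; rewrite sqr_intr_abs -natrX -[_^-1]div1r ler_pdivlMr//.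
have := ler0n R (`|i| ^ 2); have := ler0n R (`|j| ^ 2).
move: ((`|i| ^ 2)%:R : R) ((`|j| ^ 2)%:R : R) => I J J0 I0 ci W JI.
have := ewalk_ge0 m i (R := R); have := ewalk_ge0 m j (R := R).
have := wallis_ge0 m (R := R).
move: (ewalk m i) (ewalk m j) (wallis m) ci W cj => c d b ci W cj b0 d0 c0.
have h1 : c * d * (I + J) <= c * b * (I + I).
  rewrite ler_pM ?mulr_ge0 ?addr_ge0// ?ler_wpM2l// lerD2l//.
have h2 : c * I * b <= b * m%:R * b.
  by rewrite ler_wpM2r// (le_trans _ ci)// ler_wpM2l// lerDr ltW.
have : b * m%:R * b <= 1 by rewrite mulrAC -expr2.
lra.
Qed.

(** The subtracted products sum to at most 3: one for [m = 0], and [M i j] further terms of at most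
    [2 / M i j]. *)
Lemma even_sum_ge i j : (0 < M i j)%N ->
  ln (M i j)%:R / pi - 3%:R <= even_sum (M i j) i j.
Proof.
move=> M0; set N := M i j.
have p0 : 0 < pi :> R by exact: pi_gt0.
have h : \sum_(m < N.+1) ewalk m i * ewalk m j <= 3%:R :> R.
  rewrite big_ord_recl /=.
  have -> : 3%:R = 1 + 2%:R :> R by ring.
  apply: lerD.
    have w0 := wallis0 (R := R).
    by rewrite -[1]mulr1 ler_pM ?ewalk_ge0// -w0 ewalk_le.
  apply: (@le_trans _ _ (\sum_(m < N) 2%:R / N%:R)).
    by apply: ler_sum => m _; exact: ewalk_prod_le.
  by rewrite sumr_const card_ord -[_ *+ N]mulr_natr divfK// pnatr_eq0 gtn_eqF.
rewrite /even_sum sumrB lerB//.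
apply: le_trans (sum_wallis_sqr_ge N.+1).
by rewrite ler_pM2r ?invr_gt0// ler_ln ?posrE ?ltr0n// ler_nat; lia.
Qed.

(** Before time [l] the walk is too slow to reach either site, so the terms vanish. Later ones are
    of order [m^(-3/2)] by [ewalk_diff] and are dominated by the telescoping differences of
    [12 / sqrt m]. *)
Lemma even_sum_diff n i j l : (0 < l)%N ->
  (l <= `|j|)%N || (l <= `|i|)%N && (l <= absz (i + 1)%R)%N ->
  `|even_sum n (i + 1) j - even_sum n i j| <= 12%:R / Num.sqrt l%:R :> R.
Proof.
move=> l0 lij.
have trm m : `|ewalk m (i + 1) * ewalk m j - ewalk m i * ewalk m j| <=
   (if (m < l)%N then 0 else 12%:R / Num.sqrt m%:R - 12%:R / Num.sqrt m.+1%:R) :> R.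
  case: ltnP => [ml|lm].
    move: lij => /orP[lj|/andP[li li1]].
      by rewrite (@ewalk_gt _ m j) ?mulr0 ?subr0 ?normr0//; lia.
    by rewrite (@ewalk_gt _ m (i + 1)) ?(@ewalk_gt _ m i) ?mul0r ?subr0 ?normr0//; lia.
  have m0 : (0 < m)%N by lia.
  rewrite -mulrBl normrM (ger0_norm (ewalk_ge0 _ _)).
  have m1 : 1 <= m%:R :> R by rewrite ler1n.
  have s1 : 1 <= Num.sqrt m%:R :> R by rewrite -{1}[1 : R]sqrtr1 ler_sqrt// ltr0n.
  have sE : Num.sqrt m%:R ^+ 2 = m%:R :> R by rewrite sqr_sqrtr.
  have t1 : Num.sqrt m%:R <= Num.sqrt m.+1%:R :> R by rewrite ler_sqrt// ler_nat.
  have tE : Num.sqrt m.+1%:R ^+ 2 = m%:R + 1 :> R by rewrite sqr_sqrtr// natr1.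
  have W := wallis_sqr_le1 m0 (R := R).
  have dj := ewalk_le m j (R := R); have d0 := ewalk_ge0 m j (R := R).
  have D := ewalk_diff i m0 (R := R).
  have D0 := normr_ge0 (ewalk m (i + 1) - ewalk m i : R).
  have b0 := wallis_ge0 m (R := R).
  rewrite -sE in W tE.
  move: (Num.sqrt m%:R) (Num.sqrt m.+1%:R) s1 t1 W tE D D0 dj d0 b0.
  move: (`|_|) (ewalk m j) (wallis m) => D c b s t s1 st W tE Dle D0 dj d0 b0.
  have s0 : 0 < s by lra.
  have t0 : 0 < t by lra.
  have s2 : 1 <= s ^+ 2 by rewrite exprn_ege1.
  have t2s : t <= 2 * s.
    by rewrite -(ler_pXn2r (n := 2)) ?nnegrE ?mulr_ge0// ?ltW// tE exprMn; lra.
  have -> : 12 / s - 12 / t = 12 * ((t - s) / (s * t)) by field; rewrite !gt_eqF.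
  (* With [s = sqrt m] and [t = sqrt (m + 1)] one has [(t - s) (t + s) = 1], while [t^2 <= 2 s^2]
     and [t <= 2 s] give [t (t + s) <= 4 s^2]. *)
  have key : (s ^+ 3)^-1 <= 4 * ((t - s) / (s * t)).
    have -> : (t - s) / (s * t) = (s * t * (t + s))^-1.
      have E : (t - s) * (t + s) = 1 by rewrite -subr_sqr tE; ring.
      by rewrite -[RHS]mul1r -E; field; rewrite !gt_eqF//; lra.
    rewrite -[leLHS]div1r ler_pdivrMr ?exprn_gt0// mulrAC ler_pdivlMr ?mulr_gt0//; last lra.
    have : s * (t * (t + s)) <= s * (4 * s ^+ 2) by rewrite ler_wpM2l; nra.
    by rewrite mul1r; lra.
  apply: (@le_trans _ _ (3 * (s ^+ 3)^-1)); last by lra.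
  rewrite -[leRHS]/(3 / (s ^+ 3)) ler_pdivlMr ?exprn_gt0//.
  have h1 : D * s * c <= 3 * b * b by rewrite ler_pM// ?mulr_ge0// ltW.
  have h2 : b ^+ 2 * s ^+ 2 <= 1 by rewrite -ler_pdivlMr ?exprn_gt0// div1r.
  have : D * s * c * s ^+2 <= 3 * b * b * s ^+ 2 by rewrite ler_wpM2r// sqr_ge0.
  lra.
have sum_le q : \sum_(m < q) `|ewalk m (i + 1) * ewalk m j - ewalk m i * ewalk m j| <=
   12%:R / Num.sqrt l%:R - (if (q <= l)%N then 12%:R / Num.sqrt l%:R else 12%:R / Num.sqrt q%:R) :> R.
  elim: q => [|q IH]; first by rewrite big_ord0 subrr.
  rewrite big_ord_recr /=; apply: le_trans (lerD IH (trm q)) _.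
  have [ql|lq] := ltnP q l; first by rewrite (ltnW ql) addr0.
  have [->|lq'] := eqVneq q l; first by rewrite leqnn subrr add0r.
  by rewrite leqNgt ltn_neqAle eq_sym lq' lq /=; lra.
rewrite /even_sum -sumrB; apply: le_trans (ler_norm_sum _ _ _) _.
rewrite (eq_bigr (fun m : 'I_n.+1 => `|ewalk m (i + 1) * ewalk m j - ewalk m i * ewalk m j|));
  last by move=> m _; rewrite -normrN; congr (`|_|); ring.
apply: le_trans (sum_le _) _.
by rewrite gerBl; case: ifP => _; rewrite divr_ge0 ?sqrtr_ge0.
Qed.

End even_partial_sums.

(** * Potential kernel *)

Lemma cvg_sumr (R : realType) (T I : Type) (F : set_system T) (r : seq I)
    (f : I -> T -> R) (l : I -> R) : Filter F ->
  (forall i, f i x @[x --> F] --> l i) ->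
  \sum_(i <- r) f i x @[x --> F] --> \sum_(i <- r) l i.
Proof.
by move=> FF H; apply: cvg_big => [|i _]; [exact: add_continuous|exact: H].
Qed.

Section lattice_norm.
Context {R : realType}.
Implicit Types (x y z : Z2).

Definition nsq x : R := x.1%:~R ^+ 2 + x.2%:~R ^+ 2.

Lemma nsq_ge0 x : 0 <= nsq x.
Proof. by rewrite addr_ge0// sqr_ge0. Qed.

Lemma enormE x : enorm R x = Num.sqrt (nsq x). Proof. by []. Qed.

Lemma nsqD x y : nsq (x + y) <= 2%:R * nsq x + 2%:R * nsq y.
Proof.
rewrite /nsq /= !rmorphD /=.
move: (x.1%:~R : R) (x.2%:~R : R) (y.1%:~R : R) (y.2%:~R : R) => a b c d.
have := sqr_ge0 (a - c); have := sqr_ge0 (b - d); lra.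
Qed.

Lemma nsqN x : nsq (- x) = nsq x.
Proof. by rewrite /nsq /= !rmorphN /= !sqrrN. Qed.

Lemma nsq_step (i : 'I_4) : nsq (step i) = 1.
Proof.
rewrite /nsq /step; case: i => -[|[|[|[|//]]]] ilt /=.
all: by rewrite ?mulrN1z ?sqrrN ?expr1n ?expr0n /= ?mulr0z ?expr0n /= ?addr0 ?add0r.
Qed.

Lemma at_infinityP (E : set Z2) :
  at_infinity R E <-> exists r, forall y, r < nsq y -> E y.
Proof.
split=> -[r rE].
  exists (r ^+ 2) => y ry; apply: rE; rewrite enormE.
  have r0 : 0 <= r ^+ 2 by rewrite sqr_ge0.
  apply: le_lt_trans (ler_norm r) _.
  by rewrite -sqrtr_sqr ltr_sqrt// (le_lt_trans r0).
exists (`|r| + 1) => y; rewrite enormE => ry; apply: rE.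
have r1 : 0 <= `|r| + 1 by rewrite addr_ge0.
have : (`|r| + 1) ^+ 2 < nsq y.
  by rewrite -(@sqr_sqrtr _ (nsq y)) ?nsq_ge0// ltr_pXn2r ?nnegrE ?sqrtr_ge0.
apply: le_lt_trans; have := ler_norm r; have := normr_ge0 r; nra.
Qed.

#[global] Instance at_infinity_filter : ProperFilter (at_infinity R).
Proof.
apply: Build_ProperFilter_ex.
  move=> E [r rE]; exists ((Num.trunc `|r|).+1 : int, 0); apply: rE.
  rewrite enormE /nsq /= expr0n addr0 sqrtr_sqr -pmulrn ger0_norm//.
  by apply: le_lt_trans (ler_norm r) _; rewrite truncnS_gt.
split.
- by exists 0.
- move=> E F [r rE] [s sF]; exists (Num.max r s) => y.
  by rewrite gt_max => /andP[ry sy]; split; [exact: rE|exact: sF].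
- by move=> E F EF [r rE]; exists r => y /rE; exact: EF.
Qed.

Lemma cvg_shift_infinity z : (y + z) @[y --> at_infinity R] --> at_infinity R.
Proof.
move=> E /at_infinityP[r rE]; apply/at_infinityP.
exists (2%:R * r + 2%:R * nsq z) => y ry; apply: rE.
have := nsqD (y + z) (- z); rewrite addrK nsqN; lra.
Qed.

Lemma near_infinity_gt (r : R) : \forall y \near at_infinity R, r < nsq y.
Proof. by apply/at_infinityP; exists r. Qed.

End lattice_norm.

(** * Existence, logarithmic growth and vanishing increments of the potential kernel *)

Section potential_kernel_facts.
Context {R : realType}.
Implicit Types (x y z : Z2) (k n m : nat).
Local Notation p := (@step_sum_prob R).
Local Notation a := (@potential_kernel R).

Lemma even_sum_cvg i j : cvgn (fun n => even_sum n i j : R).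
Proof.
apply: nondecreasing_is_cvgn; first exact: even_sum_nd.
have [M0|] := posnP (`|i| ^ 2 + `|j| ^ 2); last first.
  move=> /even_sum_le H; eexists => _ [n _ <-]; exact: H.
have [-> ->] : i = 0 /\ j = 0 by split; lia.
exists 0 => _ [n _ <-]; rewrite /even_sum big1// => m _.
by rewrite expr2 subrr.
Qed.

(** Parity dichotomy: an odd site has only even neighbours. Facts computed explicitly at even sites
    thereby pass to odd ones through [avg]. *)
Lemma diagP x : {q | x = diag q.1 q.2} + {forall i, exists q, x + step i = diag q.1 q.2}.
Proof.
have [e|o] := boolP (odd (`|x.1| + `|x.2|)); [right|left].
  move=> i; exists (((x + step i).1 + (x + step i).2) %/ 2, ((x + step i).1 - (x + step i).2) %/ 2)%Z.
  have : odd (`|(step i).1| + `|(step i).2|) by case: i => -[|[|[|[|]]]].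
  case: (step i) => c d /=; case: x e => p q /= e e'.
  by rewrite /diag /=; congr pair => /=; lia.
exists ((x.1 + x.2) %/ 2, (x.1 - x.2) %/ 2)%Z.
by case: x o => c d /= o; rewrite /diag /=; congr pair; lia.
Qed.

Lemma cvg_avg (f : nat -> Z2 -> R) (g : Z2 -> R) x :
  (forall i : 'I_4, f n (x + step i) @[n --> \oo] --> g (x + step i)) ->
  avg (f n) x @[n --> \oo] --> avg g x.
Proof.
move=> H; rewrite /avg; apply: cvgM; last exact: cvg_cst.
apply: cvg_sumr => i; exact: H.
Qed.

Lemma kernel_sum_cvg x : kernel_sum n x @[n --> \oo] --> a x.
Proof.
have even i j : cvgn (fun n => kernel_sum n (diag i j) : R).
  under eq_fun do rewrite kernel_sum_diag.
  exact: cvgP (cvg_comp _ _ cvg_half (@even_sum_cvg i j)).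
have [[[i j] ->]|xo] := diagP x; first exact: even.
suff H : cvgn (fun n => kernel_sum n x : R) by exact: H.
(* At an odd site [kernel_sumS] reduces the convergence to that at the four even neighbours. *)
apply: (cvgP (avg a x + 0 - p 0 x)).
rewrite -(cvg_shiftS (fun n => kernel_sum n x)).
under eq_fun do rewrite kernel_sumS.
apply: cvgB; last exact: cvg_cst.
apply: cvgD; last by rewrite (cvg_shiftS (fun n => p n 0)); exact: step_sum_prob_cvg0.
by apply: cvg_avg => i; have [[q r] ->] := xo i; exact: even.
Qed.

Lemma avg_potential_kernel x : avg a x = a x + (x == 0)%:R.
Proof.
have H : kernel_sum n.+1 x @[n --> \oo] --> a x.
  by rewrite (cvg_shiftS (fun n => kernel_sum n x)); exact: kernel_sum_cvg.
have : kernel_sum n.+1 x @[n --> \oo] --> avg a x + 0 - p 0 x.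
  under eq_fun do rewrite kernel_sumS.
  apply: cvgB; last exact: cvg_cst.
  apply: cvgD; last by rewrite (cvg_shiftS (fun n => p n 0)); exact: step_sum_prob_cvg0.
  by apply: cvg_avg => i; exact: kernel_sum_cvg.
move/(cvg_lim (@Rhausdorff R)); rewrite (cvg_lim (@Rhausdorff R) H) => ->.
by rewrite step_sum_prob0; ring.
Qed.

Lemma potential_kernel0 : a 0 = 0.
Proof.
apply: cvg_lim => //; rewrite [X in X @ _](_ : _ = fun=> 0); first exact: cvg_cst.
by apply/funext => n; rewrite big1// => m _; rewrite subrr.
Qed.

Lemma potential_kernelN x : a (- x) = a x.
Proof.
have E : (fun n => kernel_sum n (- x) : R) = (fun n => kernel_sum n x).
  by apply/funext => n; apply: eq_bigr => m _; rewrite step_sum_probN.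
by rewrite -[LHS]/(lim ((fun n => kernel_sum n (- x)) @ \oo)) E.
Qed.

Lemma even_sum_cvg_kernel i j : even_sum n i j @[n --> \oo] --> a (diag i j).
Proof.
have dbl : n.*2 @[n --> \oo] --> \oo.
  by move=> A [N _ NA]; exists N => // n /= Nn; apply: NA => /=; lia.
rewrite (_ : (fun n => even_sum n i j) = (fun n => kernel_sum n.*2 (diag i j))).
  exact: (@cvg_comp _ _ _ double (fun n => kernel_sum n (diag i j)) _ _ _ dbl (@kernel_sum_cvg _)).
by apply/funext => n; rewrite kernel_sum_diag doubleK.
Qed.

Lemma nsq_diag i j : nsq (diag i j) = 2%:R * (`|i| ^ 2 + `|j| ^ 2)%N%:R :> R.
Proof.
rewrite /nsq /= rmorphD rmorphB /= natrD !natrX -!sqr_intr_abs; ring.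
Qed.

Let ln3 : ln 3%:R <= 3%:R :> R.
Proof. by apply/ltW/ln_sublinear. Qed.

(** The bounds on [even_sum] pass to the limit with error 3; replacing [M] by
    [1 + 2 M = 1 + nsq (diag i j)] inside the logarithm costs at most 3 more. *)
Lemma potential_kernel_diag_log i j :
  `|a (diag i j) - ln (1 + nsq (diag i j)) / pi| <= 6%:R.
Proof.
have p2 : 2 <= pi :> R by exact: pi_ge2.
have p0 : 0 < pi :> R by exact: pi_gt0.
have [M0|M0] := posnP (`|i| ^ 2 + `|j| ^ 2).
  have [-> ->] : i = 0 /\ j = 0 by split; lia.
  have -> : diag 0 0 = 0 by [].
  by rewrite potential_kernel0 /nsq /= expr0n !addr0 ln1 mul0r subrr normr0.
rewrite nsq_diag; set M := (_ + _)%N in M0 *.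
have MR : 1 <= M%:R :> R by rewrite ler1n.
have up : a (diag i j) <= 3 + ln M%:R / pi.
  have /cvg_lim <- // := @even_sum_cvg_kernel i j.
  apply: limr_le; first exact: even_sum_cvg.
  by apply: nearW => n; exact: even_sum_le.
have lo : ln M%:R / pi - 3 <= a (diag i j).
  have /cvg_lim <- // := @even_sum_cvg_kernel i j.
  apply: limr_ge; first exact: even_sum_cvg.
  exists M => // n /= Mn; apply: le_trans (even_sum_ge M0) _.
  exact: even_sum_nd.
have l1 : ln M%:R <= ln (1 + 2 * M%:R) :> R by rewrite ler_ln ?posrE//; lra.
have l2 : ln (1 + 2 * M%:R) <= 3 + ln M%:R :> R.
  apply: (@le_trans _ _ (ln 3 + ln M%:R)); last by rewrite lerD2r ln3.
  by rewrite -lnM ?posrE ?ler_ln ?posrE//; lra.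
have d1 : ln M%:R / pi <= ln (1 + 2 * M%:R) / pi :> R by rewrite ler_pM2r ?invr_gt0.
have d2 : ln (1 + 2 * M%:R) / pi <= 3 + ln M%:R / pi :> R.
  rewrite ler_pdivrMr//.
  have -> : (3 + ln M%:R / pi) * pi = 3 * pi + ln M%:R :> R.
    by rewrite mulrDl (divfK (lt0r_neq0 p0)).
  lra.
by rewrite ler_norml; apply/andP; split; lra.
Qed.

Lemma nsq_ge_step x (i : 'I_4) : 1 + nsq (x + step i) <= 3%:R * (1 + nsq x) :> R.
Proof. have := @nsqD R x (step i); rewrite nsq_step; have := @nsq_ge0 R x; lra. Qed.

Lemma ln_nsq_step x (i : 'I_4) :
  `|ln (1 + nsq (x + step i)) / pi - ln (1 + nsq x) / pi| <= 3%:R :> R.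
Proof.
have p2 : 2 <= pi :> R by exact: pi_ge2.
have p0 : 0 < pi :> R by exact: pi_gt0.
have key (u v : R) : 0 <= u -> 0 <= v -> 1 + u <= 3 * (1 + v) -> ln (1 + u) <= 3 + ln (1 + v).
  move=> u0 v0 uv; apply: (@le_trans _ _ (ln 3 + ln (1 + v))); last by rewrite lerD2r ln3.
  by rewrite -lnM ?posrE ?ler_ln ?posrE//; lra.
have H1 := key _ _ (nsq_ge0 _) (nsq_ge0 _) (nsq_ge_step x i).
have H2 : ln (1 + nsq x) <= 3 + ln (1 + nsq (x + step i)) :> R.
  apply: key; rewrite ?nsq_ge0//.
  have := @nsqD R (x + step i) (- step i); rewrite addrK nsqN nsq_step.
  have := @nsq_ge0 R (x + step i); lra.
rewrite -mulrBl normrM (@ger0_norm _ pi^-1) ?invr_ge0 ?pi_ge0// ler_pdivrMr//.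
apply: (@le_trans _ _ 3); last by lra.
by rewrite ler_norml; apply/andP; split; lra.
Qed.

Lemma avg_norm_le (f : Z2 -> R) x c (C : R) :
  (forall i, `|f (x + step i) - c| <= C) -> `|avg f x - c| <= C.
Proof.
move=> H.
have -> : avg f x - c = (\sum_(i < 4) (f (x + step i) - c)) / 4.
  by rewrite sumrB sumr_const card_ord /avg -[c *+ 4]mulr_natr; field.
rewrite normrM [`|_^-1|]ger0_norm// ler_pdivrMr//.
apply: le_trans (ler_norm_sum _ _ _) _.
apply: le_trans (ler_sum _ (fun i _ => H i)) _.
by rewrite sumr_const card_ord mulr_natr.
Qed.

Lemma diag_neq0 x (i : 'I_4) : (exists q, x + step i = diag q.1 q.2) -> x != 0.
Proof.
move=> [[q r]] /= E; apply/eqP => x0; move: E; rewrite x0 add0r /diag.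
by case: i => -[|[|[|[|//]]]] ? /= [] *; lia.
Qed.

(** At an odd site the value is the mean over even neighbours: error 6 there, plus 3 for moving the
    logarithm by one step. *)
Lemma potential_kernel_log x :
  `|a x - ln (1 + nsq x) / pi| <= 9%:R.
Proof.
have [[[i j] ->]|xo] := diagP x.
  by apply: le_trans (potential_kernel_diag_log i j) _; lra.
have x0 : x != 0 by exact: (diag_neq0 (xo ord0)).
have := avg_potential_kernel x; rewrite (negbTE x0) addr0 => <-.
apply: avg_norm_le => i.
have [[q r] /= E] := xo i; have := ln_nsq_step x i; rewrite E => H.
have := potential_kernel_diag_log q r; move: H; rewrite !ler_norml => /andP[? ?] /andP[? ?].
by apply/andP; split; lra.
Qed.

(** The two coordinates are moved one after the other, each at cost [12 / sqrt l]. The margin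
    [l + 2] keeps the far coordinate at least [l] away from 0 throughout. *)
Lemma even_shift_diff i j (q r : int) l : (0 < l)%N -> (`|q| <= 1)%N -> (`|r| <= 1)%N ->
  (l.+2 <= `|i|)%N || (l.+2 <= `|j|)%N ->
  `|a (diag (i + q) (j + r)) - a (diag i j)| <= 24%:R / Num.sqrt l%:R.
Proof.
move=> l0 q1 r1 lij.
have swap n s t : even_sum n s t = even_sum n t s :> R.
  by apply: eq_bigr => m _; congr (_ - _); rewrite mulrC.
have one n s t (e : int) : (`|e| <= 1)%N -> (l.+1 <= `|s|)%N || (l.+1 <= `|t|)%N ->
    `|even_sum n (s + e) t - even_sum n s t| <= 12%:R / Num.sqrt l%:R :> R.
  move=> e1 lst.
  have [->|[->|->]] : e = 0 \/ e = 1 \/ e = -1 by lia.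
  - by rewrite addr0 subrr normr0 divr_ge0// sqrtr_ge0.
  - by apply: even_sum_diff => //; lia.
  - rewrite distrC -{1}[s](subrK 1); apply: even_sum_diff => //; lia.
have H n : `|even_sum n (i + q) (j + r) - even_sum n i j| <= 24%:R / Num.sqrt l%:R :> R.
  rewrite -(subrKA (even_sum n (i + q) j)); apply: le_trans (ler_normD _ _) _.
  have -> : 24 / Num.sqrt l%:R = 12 / Num.sqrt l%:R + 12 / Num.sqrt l%:R :> R.
    by rewrite -mulrDl; congr (_ / _); ring.
  apply: lerD; last by apply: one => //; lia.
  by rewrite !(swap _ (i + q)); apply: one => //; lia.
have C : `|even_sum n (i + q) (j + r) - even_sum n i j| @[n --> \oo] -->
    `|a (diag (i + q) (j + r)) - a (diag i j)|.
  by apply: cvg_norm; apply: cvgB; exact: even_sum_cvg_kernel.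
rewrite -(cvg_lim _ C)//; apply: limr_le; first exact: cvgP C.
exact: nearW.
Qed.

(** Two steps change [x1 + x2] and [x1 - x2] by -2, 0 or 2 each, hence the [diag] coordinates by at
    most 1. *)
Lemma diag_step (i j : int) (s t : 'I_4) : exists q r : int,
  [/\ diag i j + step s + step t = diag (i + q) (j + r), (`|q| <= 1)%N & (`|r| <= 1)%N].
Proof.
have E q r : step s + step t = diag q r -> diag i j + step s + step t = diag (i + q) (j + r).
  by move=> st; rewrite -addrA st /diag; congr pair => /=; ring.
case: s E => -[|[|[|[|//]]]] hs; case: t => -[|[|[|[|//]]]] ht E.
- by exists 1, 1; split=> //; exact: E.
- by exists 0, 0; split=> //; exact: E.
- by exists 1, 0; split=> //; exact: E.
- by exists 0, 1; split=> //; exact: E.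
- by exists 0, 0; split=> //; exact: E.
- by exists (-1), (-1); split=> //; exact: E.
- by exists 0, (-1); split=> //; exact: E.
- by exists (-1), 0; split=> //; exact: E.
- by exists 1, 0; split=> //; exact: E.
- by exists 0, (-1); split=> //; exact: E.
- by exists 1, (-1); split=> //; exact: E.
- by exists 0, 0; split=> //; exact: E.
- by exists 0, 1; split=> //; exact: E.
- by exists (-1), 0; split=> //; exact: E.
- by exists 0, 0; split=> //; exact: E.
- by exists (-1), 1; split=> //; exact: E.
Qed.

Lemma step_opp (s : 'I_4) : exists t, step t = - step s.
Proof.
case: s => -[|[|[|[|//]]]] hs.
- by exists (inord 1); rewrite /step inordK.
- by exists (inord 0); rewrite /step inordK.
- by exists (inord 3); rewrite /step inordK.
- by exists (inord 2); rewrite /step inordK.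
Qed.

Lemma diag_far i j l : 4%:R * l.+2%:R ^+ 2 < nsq (diag i j) :> R ->
  (l.+2 <= `|i|)%N || (l.+2 <= `|j|)%N.
Proof.
rewrite nsq_diag -!natrX -!natrM ltr_nat => H; apply/negbNE; apply/negP.
rewrite negb_or -!ltnNge => /andP[hi hj].
have : (`|i| ^ 2 < l.+2 ^ 2)%N by rewrite ltn_exp2r.
have : (`|j| ^ 2 < l.+2 ^ 2)%N by rewrite ltn_exp2r.
lia.
Qed.

(** One of [y] and [y + step s] is odd. Writing the kernel there as the mean over the neighbours
    leaves only differences between even sites two steps apart, which [even_shift_diff] controls. *)
Lemma potential_kernel_step_diff (s : 'I_4) :
  (a (y + step s) - a y) @[y --> at_infinity R] --> (0 : R).
Proof.
apply/cvgrPdist_le => /= e e0.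
pose l := (Num.trunc ((24%:R / e) ^+ 2)).+1.
have le : 24%:R / Num.sqrt l%:R <= e.
  have l0 : 0 < Num.sqrt l%:R :> R by rewrite sqrtr_gt0.
  rewrite ler_pdivrMr// mulrC -ler_pdivrMr//.
  have -> : 24 / e = Num.sqrt ((24 / e) ^+ 2) by rewrite sqrtr_sqr ger0_norm// divr_ge0// ltW.
  by rewrite ler_sqrt// ltW// truncnS_gt.
apply/at_infinityP; exists (8%:R * l.+2%:R ^+ 2 + 2) => y ry.
rewrite sub0r normrN; apply: le_trans le.
have l2 : 0 <= l.+2%:R ^+ 2 :> R by rewrite sqr_ge0.
have [[[i j] /= yE]|yo] := diagP y.
  have far : (l.+2 <= `|i|)%N || (l.+2 <= `|j|)%N.
    by apply: diag_far; rewrite -yE; lra.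
  have ys : y + step s != 0.
    have [t tE] := step_opp s.
    by apply: (@diag_neq0 _ t); exists (i, j); rewrite tE addrK.
  have := avg_potential_kernel (y + step s); rewrite (negbTE ys) addr0 => <-.
  apply: avg_norm_le => t; rewrite yE.
  by have [q [r [-> q1 r1]]] := diag_step i j s t; exact: even_shift_diff.
have y0 : y != 0 by exact: (diag_neq0 (yo ord0)).
have := avg_potential_kernel y; rewrite (negbTE y0) addr0 => <-.
rewrite distrC; apply: avg_norm_le => t.
have [[i j] /= E] := yo s; have [s' s'E] := step_opp s.
have -> : y + step t = diag i j + step s' + step t by rewrite -E s'E addrK.
rewrite E; have [q [r [-> q1 r1]]] := diag_step i j s' t; apply: even_shift_diff => //.
apply: diag_far; rewrite -E.
have := @nsqD R (y + step s) (- step s); rewrite addrK nsqN nsq_step; lra.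
Qed.

(** The shifts with this property are closed under addition and contain the four steps, which
    generate the lattice. *)
Lemma potential_kernel_shift z :
  (a (y + z) - a y) @[y --> at_infinity R] --> (0 : R).
Proof.
pose D z := (a (y + z) - a y) @[y --> at_infinity R] --> (0 : R).
have D0 : D 0.
  by rewrite /D; under eq_fun do rewrite addr0 subrr; exact: cvg_cst.
have DD z1 z2 : D z1 -> D z2 -> D (z1 + z2).
  move=> h1 h2; rewrite /D.
  have := cvgD (cvg_comp _ _ (cvg_shift_infinity z1) h2) h1; rewrite addr0 => H.
  rewrite (_ : (fun y => _) = ((fun y => a (y + z2) - a y) \o +%R^~ z1) + (fun y => a (y + z1) - a y)).
    exact: H.
  by apply/funext => y; rewrite !fctE /= addrA subrKA.
have DM z1 n : D z1 -> D (z1 *+ n).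
  by move=> h; elim: n => [//|n IH]; rewrite mulrS; exact: DD.
have step_mul (i : 'I_4) n : D (step i *+ n) by apply: DM; exact: potential_kernel_step_diff.
have hor (t : int) : D (t, 0).
  have [n [->|->]] : exists n : nat, t = n \/ t = - (n : int) by exists `|t|%N; lia.
    rewrite (_ : (_, _) = step (inord 0) *+ n)//.
    by rewrite /step inordK//= pairMnE /= mul0rn natz.
  rewrite (_ : (_, _) = step (inord 1) *+ n)//.
  by rewrite /step inordK//= pairMnE /= mul0rn mulNrn natz.
have ver (t : int) : D (0, t).
  have [n [->|->]] : exists n : nat, t = n \/ t = - (n : int) by exists `|t|%N; lia.
    rewrite (_ : (_, _) = step (inord 2) *+ n)//.
    by rewrite /step inordK//= pairMnE /= mul0rn natz.
  rewrite (_ : (_, _) = step (inord 3) *+ n)//.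
  by rewrite /step inordK//= pairMnE /= mul0rn mulNrn natz.
case: z => s t; have -> : (s, t) = (s, 0) + (0, t) by congr pair => /=; rewrite ?addr0 ?add0r.
exact: DD.
Qed.

End potential_kernel_facts.

(** * Discrete potential theory *)

Section maximum_principle.
Context {R : realType}.
Implicit Types (x y : Z2) (h : Z2 -> R) (A D : set Z2).
Local Notation a := (@potential_kernel R).

Lemma avgB (f g : Z2 -> R) x : avg (fun y => f y - g y) x = avg f x - avg g x.
Proof. by rewrite !avgE; ring. Qed.

Lemma avgZ (c : R) (f : Z2 -> R) x : avg (fun y => c * f y) x = c * avg f x.
Proof. by rewrite !avgE; ring. Qed.

Lemma seq_argmax (s : seq Z2) h x : x \in s ->
  exists2 y, y \in s & forall z, z \in s -> h z <= h y.
Proof.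
elim: s x => // b s IH x _.
case: s IH => [_|c s IH].
  by exists b; rewrite ?inE// => z; rewrite inE => /eqP ->.
have [y ys ymax] := IH c (mem_head _ _).
have [hy|hb] := leP (h b) (h y).
  exists y; first by rewrite inE ys orbT.
  by move=> z; rewrite inE => /orP[/eqP -> //|/ymax].
exists b; first by rewrite mem_head.
move=> z; rewrite inE => /orP[/eqP -> //|/ymax /le_trans]; apply; exact: ltW.
Qed.

(** If the maximum over [D] exceeded [M], the right neighbour of a maximizer would be a maximizer
    inside [D] again, and a whole horizontal ray would stay in a finite set. *)
Lemma maximum_principle D h (M : R) : finite_set D ->
  (forall x, D x -> h x <= avg h x) ->
  (forall x (i : 'I_4), D x -> ~ D (x + step i) -> h (x + step i) <= M) ->
  forall x, D x -> h x <= M.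
Proof.
move=> /finite_seqP[s ->] sub bnd x /= xs.
have [y ys ymax] := seq_argmax h xs.
apply: le_trans (ymax _ xs) _; rewrite leNgt; apply/negP => My.
have run n : y + (n%:Z, 0) \in s /\ h (y + (n%:Z, 0)) = h y.
  elim: n => [|n [IHs IHh]]; first by rewrite addr0.
  set z := y + (n%:Z, 0) in IHs IHh.
  have nb (i : 'I_4) : h (z + step i) <= h y.
    have [zs|zs] := boolP (z + step i \in s); first exact: ymax.
    by apply: le_trans (ltW My); apply: bnd => //; exact/negP.
  have Ez : y + (n.+1%:Z, 0) = z + step ord0.
    by rewrite /z -addrA; congr (_ + _); congr pair => /=; lia.
  have Eh : h (z + step ord0) = h y.
    apply/le_anti; rewrite nb /=.
    have := sub _ IHs; rewrite IHh avgE.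
    have := nb (inord 1); have := nb (inord 2); have := nb (inord 3).
    by rewrite /step !inordK//=; lra.
  rewrite Ez Eh; split=> //; apply/negPn/negP => zs.
  by have := bnd _ ord0 IHs (elimN idP zs); rewrite Eh leNgt My.
have [B sB] : exists B : int, forall z, z \in s -> z.1 <= B.
  elim: {xs ys ymax run sub bnd} s => [|b s [B sB]]; first by exists 0.
  exists (Num.max b.1 B) => z; rewrite inE le_max => /orP[/eqP ->|/sB ->]; rewrite ?lexx ?orbT//.
by have [/sB /=] := run (`|B| + `|y.1|).+1%N; lia.
Qed.

Lemma eballE N : eball R N = [set x | nsq x <= N%:R ^+ 2 :> R].
Proof.
apply/seteqP; split=> x; rewrite /eball /= enormE => h.
  by rewrite -(@sqr_sqrtr _ (nsq x)) ?nsq_ge0// ler_pXn2r ?nnegrE ?sqrtr_ge0.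
by rewrite -[leRHS](@ger0_norm R)// -sqrtr_sqr ler_sqrt// sqr_ge0.
Qed.

Lemma eball_finite N : finite_set (eball R N).
Proof.
pose f (q : nat * nat) : Z2 := (q.1%:Z - N%:Z, q.2%:Z - N%:Z).
apply: (@sub_finite_set _ _ (f @` (`I_(N + N).+1 `*` `I_(N + N).+1))); last first.
  by apply: finite_image; apply: finite_setX; exact: finite_II.
have bnd (s t : int) : (s%:~R ^+ 2 + t%:~R ^+ 2 <= N%:R ^+ 2 :> R) -> (`|s| <= N)%N.
  move=> st; rewrite -(ler_nat R) -(ler_pXn2r (n := 2)) ?nnegrE// -sqr_intr_abs.
  by apply: le_trans st; rewrite lerDl sqr_ge0.
rewrite eballE => -[s t]; rewrite /nsq /= => st.
have s_le := bnd _ _ st; rewrite addrC in st; have t_le := bnd _ _ st.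
exists (absz (s + N%:Z), absz (t + N%:Z)) => /=; first by split => /=; lia.
by rewrite /f /=; congr pair; lia.
Qed.

Lemma subharmonic_le0 A h :
  (forall x, ~ A x -> h x <= avg h x) -> (forall x, A x -> h x <= 0) ->
  (\forall y \near at_infinity R, h y <= 0) ->
  forall x, h x <= 0.
Proof.
move=> sub hA /at_infinityP[r rh] x.
have [//|Ax] := pselect (A x); first exact: hA.
pose N := (Num.trunc (Num.max r (nsq x))).+1.
have Nr : Num.max r (nsq x) < N%:R ^+ 2.
  apply: (@lt_le_trans _ _ N%:R); first exact: truncnS_gt.
  by rewrite -natrX ler_nat expnS leq_pmulr// expn_gt0.
move: Nr; rewrite gt_max => /andP[Nr Nx].
apply: (@maximum_principle (eball R N `\` A)).
- by apply: finite_setD; exact: eball_finite.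
- by move=> y [_ Ay]; exact: sub.
- move=> y i _ yi; have [Ayi|Ayi] := pselect (A (y + step i)); first exact: hA.
  apply: rh; apply: lt_trans Nr _; rewrite ltNge; apply/negP => yN.
  by apply: yi; split=> //; rewrite eballE.
- by split=> //; rewrite eballE /= ltW.
Qed.

Lemma potential_kernel_large (K : R) : \forall y \near at_infinity R, K <= a y.
Proof.
apply/at_infinityP; exists (expR (pi * (K + 9%:R))) => y ey.
have p0 : 0 < pi :> R by exact: pi_gt0.
have := @potential_kernel_log R y; rewrite ler_norml => /andP[+ _].
suff : K + 9 <= ln (1 + nsq y) / pi by lra.
rewrite ler_pdivlMr// mulrC -[leLHS]expRK ler_ln ?posrE ?expR_gt0//; last first.
  by rewrite ltr_wpDr// nsq_ge0.
by apply: ltW; apply: lt_trans ey _; rewrite ltrDr.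
Qed.

Lemma potential_kernel_ge0 x : 0 <= a x.
Proof.
rewrite -oppr_le0; apply: (@subharmonic_le0 [set 0] (fun y => - a y)).
- move=> y y0; have H := @avg_potential_kernel R y.
  move: H; rewrite !avgE; case: eqP => // _; rewrite addr0; lra.
- by move=> _ ->; rewrite potential_kernel0 oppr0.
- by apply: filterS (potential_kernel_large 0) => y; rewrite oppr_le0.
Qed.

(** Recurrence of the planar walk in analytic form: subtracting a small multiple of [a], which is
    nonnegative, harmonic off 0 and infinite at infinity, reduces the claim to [subharmonic_le0].
    The hypothesis [A 0] puts the pole of [a] inside [A]. *)
Lemma bounded_subharmonic_le0 A h (C : R) : A 0 ->
  (forall x, ~ A x -> h x <= avg h x) -> (forall x, A x -> h x <= 0) ->
  (\forall y \near at_infinity R, h y <= C) ->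
  forall x, h x <= 0.
Proof.
move=> A0 sub hA hC x; apply/ler_addgt0Pr => e e0; rewrite add0r.
(* The multiple is chosen so that the subtracted term is at most [e] at the given point [x]. *)
have d0 : 0 < e / (1 + a x).
  by rewrite divr_gt0// ltr_wpDr// potential_kernel_ge0.
set d := e / (1 + a x) in d0.
apply: (@le_trans _ _ (d * a x)); last first.
  have ax := potential_kernel_ge0 x; rewrite /d.
  by rewrite mulrAC ler_pdivrMr ?ler_pM2l; lra.
rewrite -subr_le0; apply: (@subharmonic_le0 A (fun y => h y - d * a y)).
- move=> y Ay; rewrite avgB avgZ avg_potential_kernel.
  have -> : (y == 0) = false by apply/eqP => y0; apply: Ay; rewrite y0.
  by rewrite addr0 lerD2r; exact: sub.
- by move=> y Ay; rewrite subr_le0 (le_trans (hA _ Ay))// mulr_ge0 ?potential_kernel_ge0// ltW.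
- near=> y; rewrite subr_le0; apply: (@le_trans _ _ C); first by near: y.
  rewrite mulrC -ler_pdivrMr//; near: y; exact: potential_kernel_large.
Unshelve. all: by end_near. Qed.

End maximum_principle.

(** * Equilibrium problem for a finite set *)

Section equilibrium.
Context {R : realType} (n : nat) (z : 'I_n -> Z2).
Hypothesis z_inj : injective z.
Variable i0 : 'I_n.
Hypothesis z0 : z i0 = 0.
Implicit Types (x y : Z2) (D q r : 'I_n -> R) (c t : R).
Local Notation a := (@potential_kernel R).
Local Notation A := (range z).

(** Potential of the charges [D] placed on [A], plus a constant; by [avg_combination] its discrete
    Laplacian is the charge distribution. *)
Definition combination D c y : R := c + \sum_i D i * a (y - z i).

Lemma avg_combination D c y :
  avg (combination D c) y = combination D c y + \sum_i D i * (y == z i)%:R.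
Proof.
have -> : avg (combination D c) y = c + \sum_i D i * avg a (y - z i).
  rewrite {1}/avg /combination big_split /= sumr_const card_ord exchange_big /= mulrDl.
  congr (_ + _); first by rewrite -[_ *+ 4]mulr_natr; field.
  rewrite mulr_suml; apply: eq_bigr => i _; rewrite -mulr_sumr -mulrA.
  by congr (_ * (_ / _)); apply: eq_bigr => k _; rewrite addrAC.
rewrite /combination -addrA -big_split /=; congr (_ + _).
by apply: eq_bigr => i _; rewrite avg_potential_kernel mulrDr subr_eq0.
Qed.

Lemma avg_combination_out D c y : ~ A y ->
  avg (combination D c) y = combination D c y.
Proof.
move=> Ay; rewrite avg_combination big1 ?addr0// => i _.
by case: eqP => [yz|]; rewrite ?mulr0//; case: Ay; exists i.
Qed.

Lemma avg_combination_in D c i :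
  avg (combination D c) (z i) = combination D c (z i) + D i.
Proof.
rewrite avg_combination (bigD1 i)//= eqxx mulr1 big1 ?addr0// => j ji.
by rewrite (inj_eq z_inj) eq_sym (negbTE ji) mulr0.
Qed.

Lemma combination_infinity D c :
  (combination D c y - (\sum_i D i) * a y) @[y --> at_infinity R] --> c.
Proof.
rewrite (_ : (fun y => _) = (fun y => c + \sum_i D i * (a (y - z i) - a y))); last first.
  apply/funext => y; rewrite /combination -addrA; congr (_ + _).
  by rewrite mulr_suml -sumrB; apply: eq_bigr => i _; rewrite mulrBr.
rewrite -[X in _ --> X]addr0; apply: cvgD; first exact: cvg_cst.
rewrite -[X in _ --> X](_ : \sum_(i < n) D i * 0 = 0); last first.
  by rewrite big1// => i _; rewrite mulr0.
apply: cvg_sumr => i; apply: cvgM; first exact: cvg_cst.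
exact: potential_kernel_shift.
Qed.

(** Zero total charge makes the function bounded near infinity, so the maximum principle, applied
    with both signs, shows that it vanishes; its Laplacian then returns the charges. *)
Lemma combination_eq0 D c : (forall i, combination D c (z i) = 0) ->
  \sum_i D i = 0 -> (forall i, D i = 0) /\ c = 0.
Proof.
move=> cz D0.
have le0 (s : R) : forall y, s * combination D c y <= 0.
  apply: (@bounded_subharmonic_le0 _ A _ (s * c + 1)).
  - by exists i0.
  - by move=> y Ay; rewrite avgZ avg_combination_out.
  - by move=> _ [i _ <-]; rewrite cz mulr0.
  - have : (s * combination D c y) @[y --> at_infinity R] --> s * c.
      have := @combination_infinity D c; rewrite D0.
      under eq_fun do rewrite mul0r subr0.
      by move=> H; apply: cvgM => //; exact: cvg_cst.
    by move/cvgrPdist_le => /(_ 1 ltr01); apply: filterS => y; rewrite ler_distlC => /andP[].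
have F0 y : combination D c y = 0.
  by have := le0 1 y; have := le0 (-1) y; lra.
split=> [i|].
  have := avg_combination_in D c i; rewrite !F0 add0r => <-.
  by rewrite avgE !F0; ring.
have := F0 0; rewrite /combination big1 ?addr0// => i _.
have := avg_combination_in D c i; rewrite !F0 add0r => <-.
by rewrite avgE !F0; ring.
Qed.

Lemma combination_solve r t : exists D c,
  (forall i, combination D c (z i) = r i) /\ \sum_i D i = t.
Proof.
pose K := \matrix_(i, j) a (z j - z i) : 'M[R]_n.
pose M := block_mx K (const_mx 1 : 'M[R]_(n, 1)) (const_mx 1 : 'M[R]_(1, n)) 0.
(* A row of charges and constant is sent to the row of values on [A] and total charge, so the kernel
   of [M] is the situation of [combination_eq0]. *)
have mulM (v : 'rV[R]_n) (w : 'rV[R]_1) :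
    row_mx v w *m M = row_mx (\row_j combination (fun i => v 0 i) (w 0 0) (z j))
      (const_mx (\sum_i v 0 i)).
  rewrite mul_row_block mulmx0 addr0; congr row_mx; apply/rowP => j; rewrite !mxE.
    rewrite big_ord1 !mxE mulr1 addrC /combination; congr (_ + _).
    by apply: eq_bigr => i _; rewrite !mxE.
  by apply: eq_bigr => i _; rewrite !mxE mulr1.
have Munit : M \in unitmx.
  rewrite -row_free_unit -kermx_eq0; apply/eqP/row_matrixP => k.
  rewrite row0; move: (row k _) (row_sub k (kermx M)) => v /sub_kermxP E.
  rewrite -(hsubmxK v) mulM -row_mx0 in E; move/eq_row_mx : E => [/rowP h1 /rowP h2].
  rewrite -(hsubmxK v) -row_mx0.
  have [] := @combination_eq0 (fun i => lsubmx v 0 i) (rsubmx v 0 0).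
  - by move=> i; have := h1 i; rewrite !mxE.
  - by have := h2 0; rewrite !mxE.
  move=> l0 r0; congr row_mx; apply/rowP => i; rewrite [RHS]mxE; first exact: l0.
  by rewrite ord1.
pose v := row_mx (\row_i r i) (const_mx t : 'M[R]_1) *m invmx M.
have := mulmxKV Munit (row_mx (\row_i r i) (const_mx t : 'M[R]_1)).
rewrite -/v -{1}(hsubmxK v) mulM => /eq_row_mx[/rowP h1 /rowP h2].
exists (fun i => lsubmx v 0 i), (rsubmx v 0 0); split.
  by move=> i; have := h1 i; rewrite !mxE.
by have := h2 0; rewrite !mxE.
Qed.

(** [g] is the potential of total charge 1 that vanishes on [A], and [q] is its charge. The last
    clause speaks of an arbitrary bounded harmonic [f]; for [f] a hitting probability it identifies
    [q] with harmonic measure. *)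
Lemma equilibrium : exists q, exists g : Z2 -> R,
  [/\ forall y, A y -> g y = 0,
      forall y, ~ A y -> avg g y = g y,
      forall i, avg g (z i) = q i,
      exists C, \forall y \near at_infinity R, `|g y - ln (1 + nsq y) / pi| <= C &
      forall i (f : Z2 -> R), (forall y, `|f y| <= 1) ->
        (forall y, ~ A y -> avg f y = f y) -> (forall j, f (z j) = (j == i)%:R) ->
        f y @[y --> at_infinity R] --> q i].
Proof.
have [q [c [gz q1]]] := combination_solve (fun=> 0) 1.
exists q, (combination q c); split.
- by move=> _ [i _ <-].
- by move=> y; exact: avg_combination_out.
- by move=> i; rewrite avg_combination_in gz add0r.
- exists (`|c| + 10%:R).
  have := @combination_infinity q c; rewrite q1 => /cvgrPdist_le /(_ 1 ltr01).
  apply: filterS => y; rewrite mul1r.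
  have := @potential_kernel_log R y; rewrite !ler_norml => /andP[h1 h2] /andP[h3 h4].
  have := ler_norm c; have := ler_norm (- c); rewrite normrN => h5 h6.
  by apply/andP; split; lra.
- move=> i f f1 fh fz.
  (* With total charge 0 the solution is bounded and has the same values on [A] as [f], so the two
     coincide and [f] tends to [C]. *)
  have [D [C [Fz D0]]] := combination_solve (fun j => (j == i)%:R) 0.
  have FC : combination D C y @[y --> at_infinity R] --> C.
    have := @combination_infinity D C; rewrite D0.
    by under eq_fun do rewrite mul0r subr0.
  have le0 (s : R) : forall y, s * (f y - combination D C y) <= 0.
    apply: (@bounded_subharmonic_le0 _ A _ (`|s| * (1 + (`|C| + 1)))).
    - by exists i0.
    - by move=> y Ay; rewrite avgZ avgB avg_combination_out// fh.
    - by move=> _ [j _ <-]; rewrite Fz fz subrr mulr0.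
    - move/cvgrPdist_le : FC => /(_ 1 ltr01); apply: filterS => y Cy.
      apply: le_trans (ler_norm _) _; rewrite normrM ler_wpM2l//.
      apply: le_trans (ler_normB _ _) _; rewrite lerD//.
      rewrite -[combination _ _ _](subKr C); apply: le_trans (ler_normB _ _) _.
      by rewrite lerD2l.
  have -> : f = combination D C.
    by apply/funext => y; have := le0 1 y; have := le0 (-1) y; lra.
  suff -> : q i = C by [].
  (* The pairing of [q] with the values on [A] is computed in two ways. By symmetry of [a] the
     potential of [q] on [A] is the constant [- c], which the zero total charge of [D] annihilates,
     leaving [C]. *)
  have E : \sum_j q j * combination D C (z j) = q i.
    rewrite (bigD1 i)//= Fz eqxx mulr1 big1 ?addr0// => j ji.
    by rewrite Fz (negbTE ji) mulr0.
  rewrite -E /combination; under eq_bigr do rewrite mulrDr mulr_sumr.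
  rewrite big_split /= -mulr_suml q1 mul1r exchange_big /=.
  under [X in _ + X]eq_bigr => k _.
    rewrite (eq_bigr (fun j => D k * (q j * a (z k - z j)))); last first.
      by move=> j _; rewrite -potential_kernelN opprB mulrCA.
    rewrite -mulr_sumr (_ : \sum_j q j * a (z k - z j) = - c); last first.
      by have := gz k; rewrite /combination addrC => /eqP; rewrite addr_eq0 => /eqP.
    over.
  by rewrite -mulr_suml D0 mul0r addr0.
Qed.

End equilibrium.

(** * Logarithmic asymptotics of escape functions *)

Section escape_asymptotics.
Context {R : realType}.
Implicit Types (y : Z2) (A : set Z2).

Lemma near_ln_ge (K : R) : \forall N \near \oo, K <= ln N%:R.
Proof.
exists (Num.trunc (expR K)).+1 => // N /= KN.
have KN' : expR K <= N%:R by apply: ltW; apply: lt_le_trans (truncnS_gt _) _; rewrite ler_nat.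
by rewrite -[K]expRK ler_ln ?posrE ?expR_gt0// (lt_le_trans (expR_gt0 K)).
Qed.

(** Just outside the ball, off [A], [phi N] is 1 and [g] is [lam N + O(1)], so the maximum principle
    yields [|g - lam N * phi N| <= C' * phi N] inside. This error vanishes because [phi N y] is of
    order [1 / lam N]. *)
Lemma escape_asymptotics A (g : Z2 -> R) (phi : nat -> Z2 -> R) (C : R) y :
  (forall x, A x -> g x = 0) -> (forall x, ~ A x -> avg g x = g x) ->
  (\forall x \near at_infinity R, `|g x - ln (1 + nsq x) / pi| <= C) ->
  (forall N x, 0 <= phi N x) ->
  (forall N x, A x -> phi N x = 0) ->
  (forall N x, ~ A x -> ~ eball R N x -> phi N x = 1) ->
  (forall N x, ~ A x -> eball R N x -> avg (phi N) x = phi N x) ->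
  (ln N%:R * phi N y) @[N --> \oo] --> pi / 2%:R * g y.
Proof.
move=> gA gh gC phi_ge0 phiA phi1 phih.
have p0 : 0 < pi :> R by exact: pi_gt0.
have p2 : 2 <= pi :> R by exact: pi_ge2.
pose lam N : R := 2 / pi * ln N%:R.
have lam_le K : \forall N \near \oo, K <= lam N.
  apply: filterS (near_ln_ge (K * pi / 2)) => N; rewrite /lam => KN.
  by rewrite mulrAC ler_pdivlMr//; lra.
suff H : (lam N * phi N y) @[N --> \oo] --> g y.
  rewrite (_ : (fun N => _) = (fun N => pi / 2 * (lam N * phi N y))).
    by apply: cvgM => //; exact: cvg_cst.
  apply/funext => N; rewrite /lam; move: (ln _) (phi _ _) => s t.
  by have := lt0r_neq0 p0; move: pi => p pn0; field.
have [r rC] := (@at_infinityP R _).1 gC.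
(* The 5 absorbs the logarithm of the factor in [1 + nsq x <= 5 N^2] for a site [x] one step outside
   the ball. *)
pose C' := `|C| + 5.
have C'0 : 0 < C' by rewrite /C'; have := normr_ge0 C; lra.
have [N0 N0P] : exists N0, forall N, (N0 <= N)%N ->
    [/\ r < N%:R ^+ 2, nsq y <= N%:R ^+ 2 :> R, (0 < N)%N & 2 * C' <= lam N].
  have [N1 _ N1P] := lam_le (2 * C').
  exists (maxn N1 (Num.trunc (Num.max r (nsq y))).+1) => N; rewrite geq_max => /andP[NN1 NN2].
  have : Num.max r (nsq y) < N%:R ^+ 2 :> R.
    apply: (@lt_le_trans _ _ N%:R); first by apply: lt_le_trans (truncnS_gt _) _; rewrite ler_nat.
    by rewrite -natrX ler_nat -{1}[N]expn1 leq_pexp2l//; lia.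
  rewrite gt_max => /andP[? ?]; split=> //; [exact: ltW|lia|exact: N1P].
have bnd N (s : R) : (N0 <= N)%N -> (s = 1 \/ s = -1) ->
    s * (g y - lam N * phi N y) <= C' * phi N y.
  move=> NN0 s1; have [rN yN N_gt0 lamN] := N0P N NN0.
  have [Ay|Ay] := pselect (A y); first by rewrite gA// phiA// !mulr0 subrr mulr0.
  rewrite -subr_le0.
  apply: (@maximum_principle _ (eball R N `\` A) (fun x => s * (g x - lam N * phi N x) - C' * phi N x)).
  - by apply: finite_setD; exact: eball_finite.
  - by move=> x [xN Ax]; rewrite avgB !avgZ avgB avgZ gh// phih.
  - move=> x i [xN Ax] xi; have [Axi|Axi] := pselect (A (x + step i)).
      by rewrite gA// phiA// !mulr0 subrr mulr0 subrr.
    have xiN : ~ eball R N (x + step i) by move=> ?; apply: xi.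
    rewrite phi1// !mulr1 subr_le0.
    have xiN' : N%:R ^+ 2 < nsq (x + step i) :> R.
      by rewrite ltNge; apply/negP => h; apply: xiN; rewrite eballE.
    have := rC _ (lt_trans rN xiN'); move/le_trans => /(_ _ (ler_norm C)).
    have N1 : 1 <= N%:R :> R by rewrite ler1n.
    have N2 : 1 <= N%:R ^+ 2 :> R by rewrite exprn_ege1.
    have up : 1 + nsq (x + step i) <= 5 * N%:R ^+ 2 :> R.
      have H1 := @nsqD R x (step i); rewrite nsq_step in H1.
      have H2 : nsq x <= N%:R ^+ 2 :> R by move: xN; rewrite eballE.
      lra.
    have lnN : ln (N%:R ^+ 2) = 2 * ln N%:R :> R by rewrite lnXn ?mulr_natl//; lra.
    have l1 : 2 * ln N%:R <= ln (1 + nsq (x + step i)) :> R.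
      by rewrite -lnN ler_ln ?posrE; lra.
    have l2 : ln (1 + nsq (x + step i)) <= 5 + 2 * ln N%:R :> R.
      apply: (@le_trans _ _ (ln (5 * N%:R ^+ 2))).
        by rewrite ler_ln ?posrE//; lra.
      rewrite lnM ?posrE//; last by lra.
      by rewrite lnN lerD2r ltW// ln_sublinear.
    have d1 : lam N <= ln (1 + nsq (x + step i)) / pi.
      by rewrite /lam mulrAC ler_pM2r ?invr_gt0.
    have d2 : ln (1 + nsq (x + step i)) / pi <= 5 + lam N.
      rewrite ler_pdivrMr// [leRHS]mulrDl /lam mulrAC divfK ?gt_eqF//; lra.
    rewrite ler_norml => /andP[h1 h2]; rewrite /C'.
    by case: s1 => ->; lra.
  - by split => //; rewrite eballE.
apply/cvgrPdist_le => e e0 /=.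
near=> N.
have NN0 : (N0 <= N)%N by near: N; exists N0.
have [rN yN N_gt0 lamN] := N0P N NN0.
have b1 := bnd N 1 NN0 (or_introl erefl).
have b2 := bnd N (-1) NN0 (or_intror erefl).
have ph0 := phi_ge0 N y.
have lamN0 : 0 < lam N by lra.
(* As [lam N >= 2 C'], the error [C' * phi N y] is at most half of [lam N * phi N y] and can be
   absorbed. *)
have half : lam N * phi N y <= 2 * g y.
  have : 2 * C' * phi N y <= lam N * phi N y by rewrite ler_wpM2r.
  lra.
have : 2 * C' * g y / e <= lam N by near: N; exact: lam_le.
rewrite ler_pdivrMr// => lamE.
have : C' * phi N y <= e.
  rewrite -(ler_pM2l lamN0).
  have : C' * (lam N * phi N y) <= C' * (2 * g y) by rewrite ler_pM2l.
  lra.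
by rewrite ler_norml => ?; apply/andP; split; lra.
Unshelve. all: by end_near. Qed.

End escape_asymptotics.

(** * Hitting probabilities of the jump chain *)

(** The masses add up, so the sets [B i] exhaust [A] up to a null set. This serves the one-step
    decomposition of the chain, where jumps to non-neighbours are null but not excluded
    pointwise. *)
Lemma measure_full_partition d (T : measurableType d) (R : realType)
    (mu : probability T R) n (A : set T) (B : 'I_n -> set T) (F : set T) :
  measurable A -> measurable F -> (forall i, measurable (B i)) ->
  trivIset setT B -> (forall i, B i `<=` A) ->
  (mu A = \sum_(i < n) mu (B i))%E ->
  (mu (A `&` F) = \sum_(i < n) mu (B i `&` F))%E.
Proof.
move=> mA mF mB tB BA muA.
pose V := \big[setU/set0]_(i < n) B i.
have mV : measurable V by exact: bigsetU_measurable.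
have muV : mu V = mu A by rewrite measure_semi_additive_ord.
have VA : V `<=` A by rewrite /V -bigcup_seq => x [i _]; exact: BA.
rewrite (@measureDI _ _ _ mu (A `&` F) V)//; last exact: measurableI.
rewrite [X in (X + _)%E](_ : _ = 0%E); last first.
  apply/eqP; rewrite eq_le measure_ge0 andbT.
  apply: (@le_trans _ _ (mu (A `\` V))).
    apply: le_measure; rewrite ?inE; [|exact: measurableD|by move=> x [[]]].
    by apply: measurableD => //; exact: measurableI.
  rewrite measureD// ?(le_lt_trans (probability_le1 _ _)) ?ltry//.
  rewrite (setIidr VA) [X in (_ - X)%E](_ : _ = mu A); last exact: muV.
  by rewrite subee// fin_num_measure.
rewrite add0e.
have -> : A `&` F `&` V = \big[setU/set0]_(i < n) (B i `&` F).
  rewrite setIAC (setIidr VA) /V -!bigcup_seq setI_bigcupl.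
  by apply: eq_bigcupr => i _; rewrite setIC.
rewrite measure_semi_additive_ord//.
- by move=> i; exact: measurableI.
- apply/trivIsetP => i j _ _ ij; move/trivIsetP : tB => /(_ i j I I ij) h.
  by rewrite setIACA h set0I.
- by apply: bigsetU_measurable => i _; exact: measurableI.
Qed.

Section chain.
Context {R : realType} (S : srw R).
Local Notation P := (srw_law S).
Implicit Types (x y : Z2) (U V B : set Z2) (n m k : nat) (z : nat -> Z2) (o : S).

Lemma measurable_chain n B : measurable [set o : S | B (jump_chain n o)].
Proof.
rewrite (_ : [set o | _] = \bigcup_x ([set o | x = jump_chain n o /\ B x])).
  apply: countable_bigcupT_measurable => [|x]; first exact: countableP.
  have [Bx|Bx] := pselect (B x).
    rewrite (_ : [set o | _] = jump_chain n @^-1` [set x]); first exact: measurable_jump_chain.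
    by apply/seteqP; split => o /=; [move=> [->]|move=> ->].
  by rewrite (_ : [set o | _] = set0)// -subset0 => o [].
by apply/seteqP; split => o /=; [exists (jump_chain n o)|move=> [x _ [->]]].
Qed.

Definition chain_prefix k z : set S :=
  [set o | forall i, (i <= k)%N -> jump_chain i o = z i].

Lemma measurable_chain_prefix k z : measurable (chain_prefix k z).
Proof.
rewrite (_ : chain_prefix k z = \bigcap_(i in `I_k.+1) [set o | jump_chain i o = z i]).
  apply: bigcap_measurableType => i _; exact: (measurable_chain i [set z i]).
by apply/seteqP; split => o h i /h.
Qed.

Lemma chain_prefixE x k z : P x (chain_prefix k z) =
  ((z 0%N == x)%:R * \prod_(i < k) ((adj (z i) (z i.+1))%:R / 4%:R))%:E.
Proof.
have := @srw_lawE R S x k z (fun=> setT) (fun=> measurableT).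
rewrite [X in _ = (_ * X)%E]big1 ?mule1; last first.
  by move=> i _; exact: integral_exponential_pdf.
move=> <-; congr (P x _); apply/seteqP.
by split => o h i ik; [split=> //; exact: h|have [] := h i ik].
Qed.

Definition chain_extend k z y : nat -> Z2 := fun i => if (i <= k)%N then z i else y.

Lemma step_inj : injective step.
Proof.
move=> i j; rewrite /step.
case: i => -[|[|[|[|//]]]] hi; case: j => -[|[|[|[|//]]]] hj //= _; exact: val_inj.
Qed.

Lemma chain_prefix_step x k z (F : set S) : measurable F ->
  (P x (chain_prefix k z `&` F) =
  \sum_(i < 4) P x (chain_prefix k.+1 (chain_extend k z (z k + step i)%R) `&` F))%E.
Proof.
move=> mF; apply: measure_full_partition => //.
- exact: measurable_chain_prefix.
- by move=> i; exact: measurable_chain_prefix.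
- apply/trivIsetP => i j _ _ ij; rewrite -subset0 => o [/(_ k.+1 (leqnn _)) + /(_ k.+1 (leqnn _))].
  rewrite /chain_extend ltnn => -> /addrI /step_inj; exact/eqP.
- by move=> i o h l lk; rewrite h ?(leqW lk)// /chain_extend lk.
rewrite chain_prefixE /=; under [RHS]eq_bigr => i _.
  rewrite chain_prefixE big_ord_recr /= /chain_extend leqnn ltnn leq0n.
  rewrite (_ : adj _ _ = true); last by apply/existsP; exists i.
  under eq_bigr => l _ do rewrite (ltnW (ltn_ord l)) (ltn_ord l).
  over.
rewrite sumEFin; congr (_%:E).
by rewrite sumr_const card_ord /=; field.
Qed.

Lemma chain_prefix_extend x k z (i : 'I_4) :
  P x (chain_prefix k.+1 (chain_extend k z (z k + step i))) = (P x (chain_prefix k z) * (4%:R^-1)%:E)%E.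
Proof.
rewrite !chain_prefixE big_ord_recr /= /chain_extend leqnn ltnn leq0n.
rewrite (_ : adj _ _ = true); last by apply/existsP; exists i.
under eq_bigr => l _ do rewrite (ltnW (ltn_ord l)) (ltn_ord l).
by rewrite -EFinM; congr (_%:E); rewrite /=; field.
Qed.

(** Probability of entering [U] at one of the times 1 to [n] with no visit to [V] from time 1 up to
    and including that time; the starting point itself is not tested. *)
Fixpoint hit_within U V n y : R :=
  if n is n'.+1 then
    avg (fun y' => if `[< V y' >] then 0 else if `[< U y' >] then 1 else hit_within U V n' y') y
  else 0.

Definition reach_within U V k n : set S :=
  [set o | exists m, [/\ (m < n)%N, U (jump_chain (k + m).+1 o) &
     forall j, (j <= m)%N -> ~ V (jump_chain (k + j).+1 o)]].

Lemma measurable_reach_within U V k n : measurable (reach_within U V k n).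
Proof.
rewrite (_ : reach_within U V k n = \bigcup_(m in `I_n) ([set o | U (jump_chain (k + m).+1 o)] `&`
   \bigcap_(j in `I_m.+1) [set o | (~` V) (jump_chain (k + j).+1 o)])).
  apply: bigcup_measurable => m _; apply: measurableI; first exact: measurable_chain.
  by apply: bigcap_measurableType => j _; exact: measurable_chain.
apply/seteqP; split => o /=.
  by move=> [m [mn Um Vm]]; exists m => //; split=> // j; exact: Vm.
by move=> [m mn [Um Vm]]; exists m; split=> // j; exact: Vm.
Qed.

(** Markov property at time [k], by induction on [n] for all prefixes at once: conditioning on the
    next step lengthens the prefix by one and shortens the horizon by one. *)
Lemma reach_withinE U V n x k z :
  (P x (chain_prefix k z `&` reach_within U V k n) =
   P x (chain_prefix k z) * (hit_within U V n (z k))%:E)%E.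
Proof.
elim: n k z => [|n IH] k z.
  rewrite mule0 (_ : reach_within _ _ _ _ = set0) ?setI0 ?measure0//.
  by rewrite -subset0 => o [m []].
rewrite chain_prefix_step; last exact: measurable_reach_within.
rewrite (eq_bigr (fun i : 'I_4 => P x (chain_prefix k z) * (4%:R^-1)%:E *
  (if `[< V (z k + step i)%R >] then 0 else if `[< U (z k + step i)%R >] then 1 else
   hit_within U V n (z k + step i)%R)%:E)%E).
  under eq_bigr do rewrite -muleA -EFinM mulrC.
  have -> : P x (chain_prefix k z) = (fine (P x (chain_prefix k z)))%:E.
    by rewrite fineK// fin_num_measure//; exact: measurable_chain_prefix.
  under eq_bigr do rewrite -EFinM.
  rewrite sumEFin -EFinM; congr (_%:E).
  by rewrite /= /avg -mulr_sumr mulr_suml.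
move=> i _; set y := z k + step i; set z' := chain_extend k z y.
rewrite -(chain_prefix_extend x k z i) -/y -/z'.
have zk : z' k.+1 = y by rewrite /z' /chain_extend ltnn.
case: asboolP => [Vy|Vy].
  rewrite mule0 (_ : _ `&` _ = set0) ?measure0// -subset0.
  move=> o [/(_ _ (leqnn _)) yE [m [_ _ /(_ 0%N (leq0n _))]]].
  by rewrite addn0 yE zk.
case: asboolP => [Uy|Uy].
  rewrite mule1; congr (P x _); apply/seteqP; split => [ o [] //|o oz]; split=> //.
  exists 0%N; rewrite addn0 (oz _ (leqnn _)) zk; split=> // -[|//] _.
  by rewrite addn0 (oz _ (leqnn _)) zk.
rewrite -zk -IH; congr (P x _); apply/seteqP; split => o [oz]; move=> [m [mn Um Vm]]; split=> //.
  case: m mn Um Vm => [|m] mn Um Vm.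
    by case: Uy; rewrite -zk -(oz _ (leqnn _)); move: Um; rewrite addn0.
  exists m; split=> //; first by rewrite addSnnS.
  by move=> j jm; rewrite addSnnS; exact: Vm.
exists m.+1; split=> //; first by rewrite -addSnnS.
move=> [|j] jm; first by rewrite addn0 (oz _ (leqnn _)) zk.
by rewrite -addSnnS; exact: Vm.
Qed.

Definition before U V : set S :=
  [set o | exists n, U (jump_chain n o) /\
     forall k, (k <= n)%N -> ~ V (jump_chain k o)].

Definition before_after U V : set S :=
  [set o | exists n, U (jump_chain n.+1 o) /\
     forall k, (k <= n)%N -> ~ V (jump_chain k.+1 o)].

Lemma before_afterE U V : before_after U V = \bigcup_n reach_within U V 0 n.
Proof.
apply/seteqP; split => o.
  by move=> [n [Un Vn]]; exists n.+1 => //; exists n.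
by move=> [n _ [m [_ Um Vm]]]; exists m.
Qed.

Lemma measurable_before_after U V : measurable (before_after U V).
Proof. by rewrite before_afterE; apply: bigcupT_measurable => n; exact: measurable_reach_within. Qed.

Lemma measurable_before U V : measurable (before U V).
Proof.
rewrite (_ : before U V = \bigcup_m ([set o | U (jump_chain m o)] `&`
   \bigcap_(j in `I_m.+1) [set o | (~` V) (jump_chain j o)])).
  apply: bigcup_measurable => m _; apply: measurableI; first exact: measurable_chain.
  by apply: bigcap_measurableType => j _; exact: measurable_chain.
apply/seteqP; split => o /=.
  by move=> [m [Um Vm]]; exists m => //; split=> // j; exact: Vm.
by move=> [m _ [Um Vm]]; exists m; split=> // j; exact: Vm.
Qed.

Lemma chain_start x : P x (chain_prefix 0 (fun=> x)) = 1%E.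
Proof. by rewrite chain_prefixE eqxx big_ord0 mulr1. Qed.

Lemma law_start x (F : set S) : measurable F ->
  P x F = P x ([set o | jump_chain 0 o = x] `&` F).
Proof.
move=> mF.
have E : chain_prefix 0 (fun=> x) = [set o | jump_chain 0 o = x].
  by apply/seteqP; split => o; [apply|move=> ox i; rewrite leqn0 => /eqP ->].
rewrite -E; have m0 : measurable (chain_prefix 0 (fun=> x)) by exact: measurable_chain_prefix.
rewrite [LHS](@measureDI _ _ _ (P x) F (chain_prefix 0 (fun=> x)))// setIC.
rewrite [X in (X + _)%E](_ : _ = 0%E) ?add0e//.
apply/eqP; rewrite eq_le measure_ge0 andbT.
have h0 : P x (~` chain_prefix 0 (fun=> x)) = 0%E.
  by rewrite probability_setC// chain_start subee.
rewrite -h0; apply: le_measure; rewrite ?inE; [exact: measurableD|exact: measurableC|].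
by move=> o [].
Qed.

Definition hit_prob U V x : R := fine (P x (before U V)).
Definition hit_after_prob U V x : R := fine (P x (before_after U V)).

Lemma hit_within_cvg U V x :
  hit_within U V n x @[n --> \oo] --> hit_after_prob U V x.
Proof.
have E n : P x (reach_within U V 0 n) = (hit_within U V n x)%:E.
  rewrite (law_start _ (measurable_reach_within _ _ _ _)).
  have := @reach_withinE U V n x 0 (fun=> x); rewrite chain_start mul1e => <-.
  congr (P x (_ `&` _)); apply/seteqP; split => o; last by apply.
  by move=> ox i; rewrite leqn0 => /eqP ->.
have : P x \o reach_within U V 0 @ \oo --> P x (\bigcup_n reach_within U V 0 n).
  apply: nondecreasing_cvg_mu.
  - by move=> n; exact: measurable_reach_within.
  - by rewrite -before_afterE; exact: measurable_before_after.
  - by apply/nondecreasing_seqP => n; apply/subsetPset => o [m [mn ? ?]]; exists m; split=> //; exact: ltnW.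
rewrite -before_afterE.
have -> : P x (before_after U V) = (hit_after_prob U V x)%:E.
  by rewrite fineK// fin_num_measure//; exact: measurable_before_after.
rewrite (_ : P x \o _ = EFin \o (fun n => hit_within U V n x)); last by apply/funext => n /=.
by move/fine_cvgP => [].
Qed.

Lemma hit_probE U V x : hit_prob U V x =
  if `[< V x >] then 0 else if `[< U x >] then 1 else hit_after_prob U V x.
Proof.
rewrite /hit_prob (law_start _ (measurable_before _ _)).
case: asboolP => [Vx|Vx].
  rewrite (_ : _ `&` _ = set0) ?measure0// -subset0 => o [/= ox [m [_ /(_ 0%N (leq0n _))]]].
  by rewrite ox.
case: asboolP => [Ux|Ux].
  rewrite (_ : _ `&` _ = [set o | jump_chain 0 o = x]).
    have := law_start x (F := setT) measurableT; rewrite setIT probability_setT => <-//.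
  apply/seteqP; split => [ o [] //|o /= ox]; split=> //.
  by exists 0%N; rewrite ox; split=> // k; rewrite leqn0 => /eqP ->; rewrite ox.
rewrite /hit_after_prob (law_start _ (measurable_before_after _ _)); congr (fine (P x _)).
apply/seteqP; split => o /= [ox [m [Um Vm]]]; split=> //.
  case: m Um Vm => [|m] Um Vm; first by rewrite ox in Um.
  by exists m; split=> // k km; exact: Vm.
by exists m.+1; split=> // -[|k] km; [rewrite ox|exact: Vm].
Qed.

(** The recursion of [hit_within] in the limit of infinite horizon; together with [hit_probE] it
    makes [hit_prob U V] harmonic off [U] and [V]. *)
Lemma hit_after_probE U V x : hit_after_prob U V x = avg (hit_prob U V) x.
Proof.
have H : hit_within U V n.+1 x @[n --> \oo] --> avg (hit_prob U V) x.
  apply: cvg_avg => i; rewrite hit_probE.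
  case: asboolP => _; first exact: cvg_cst.
  by case: asboolP => _; [exact: cvg_cst|exact: hit_within_cvg].
have := @hit_within_cvg U V x; rewrite -(cvg_shiftS (fun n => hit_within U V n x)).
by move=> /(cvg_lim (@Rhausdorff R)) <-; rewrite (cvg_lim (@Rhausdorff R) H).
Qed.

Lemma hit_prob_ge0 U V x : 0 <= hit_prob U V x.
Proof. by rewrite fine_ge0. Qed.

Lemma hit_prob_le1 U V x : hit_prob U V x <= 1.
Proof.
rewrite -lee_fin fineK ?probability_le1//; first exact: measurable_before.
by rewrite fin_num_measure//; exact: measurable_before.
Qed.

End chain.

(** * Reduction of the continuous-time walk to its jump chain *)

Section continuous_time.
Context {R : realType} (S : srw R).
Local Notation P := (srw_law S).
Implicit Types (x y : Z2) (U V A : set Z2) (n m k j : nat) (o : S) (t : R).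

Lemma jump_time0 o : jump_time 0 o = 0.
Proof. by rewrite /jump_time big_ord0. Qed.

Lemma jump_time_ltS n o : jump_time n o < jump_time n.+1 o.
Proof. by rewrite /jump_time big_ord_recr /= ltrDl hold_gt0. Qed.

Lemma jump_time_le m n o : (m <= n)%N -> jump_time m o <= jump_time n o.
Proof.
move=> mn; rewrite -(subnKC mn); elim: (n - m)%N => [|l IH]; first by rewrite addn0.
by rewrite addnS (le_trans IH)// ltW// jump_time_ltS.
Qed.

Lemma jump_time_lt_inv m n o : jump_time m o < jump_time n o -> (m < n)%N.
Proof. by rewrite ltnNge; apply: contraTN => /(jump_time_le o); rewrite leNgt. Qed.

Lemma X_jump_chain n t o : jump_time n o <= t < jump_time n.+1 o ->
  X t o = jump_chain n o.
Proof.
move=> tn; rewrite /X; case: xgetP => [m _ /= tm|/(_ n)//].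
suff -> : m = n by [].
move: tn tm => /andP[n1 n2] /andP[m1 m2]; apply/eqP; rewrite eqn_leq -[(m <= n)%N]ltnS -[(n <= m)%N]ltnS.
by rewrite (jump_time_lt_inv (le_lt_trans m1 n2)) (jump_time_lt_inv (le_lt_trans n1 m2)).
Qed.

Lemma X_jump_time n o : X (jump_time n o) o = jump_chain n o.
Proof. by apply: X_jump_chain; rewrite lexx jump_time_ltS. Qed.

Lemma jump_time_bracket t o : 0 <= t ->
  exists n, jump_time n o <= t < jump_time n.+1 o.
Proof.
move=> t0; have [n nt] : exists n, t < jump_time n o.
  have /cvgryPgt /(_ t) [n _ nP] := @hold_cvgy _ S o.
  by exists n; exact: nP (leqnn n).
elim: n nt => [|n IH] nt; first by rewrite jump_time0 in nt; lra.
have [/IH//|tn] := ltP t (jump_time n o); exists n; by rewrite tn.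
Qed.

Lemma hit_from_le j k V o : (j <= k)%N -> V (jump_chain k o) ->
  (hit_from (jump_time j o) V o <= (jump_time k o)%:E)%E.
Proof.
move=> jk Vk; apply: ereal_inf_lbound; exists (jump_time k o) => //=.
by split; [exact: jump_time_le|rewrite X_jump_time].
Qed.

Lemma hit_from_time j V o t : jump_time j o <= t -> V (X t o) ->
  exists n, [/\ (j <= n)%N, V (jump_chain n o) & jump_time n o <= t].
Proof.
move=> jt Vt; have t0 : 0 <= t.
  by rewrite (le_trans _ jt)// -(jump_time0 o) jump_time_le.
have [n tn] := jump_time_bracket o t0; exists n; move: (tn) => /andP[n1 n2].
split=> //; last by rewrite -(X_jump_chain tn).
by rewrite -ltnS; exact: jump_time_lt_inv (le_lt_trans jt n2).
Qed.

Lemma hit_from_ge j n V o :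
  (forall k, (j <= k)%N -> (k < n)%N -> ~ V (jump_chain k o)) ->
  ((jump_time n o)%:E <= hit_from (jump_time j o) V o)%E.
Proof.
move=> Vn; apply: le_ereal_inf_tmp => _ [t [jt Vt] <-].
have [k [jk Vk kt]] := hit_from_time jt Vt.
rewrite lee_fin (le_trans _ kt)// jump_time_le// leqNgt; apply/negP => kn.
exact: Vn Vk.
Qed.

(** The path is constant between jumps, so only jump times matter, and these increase strictly. The
    cases [j = 0] and [j = 1] cover hitting times with and without time 0. *)
Lemma hit_lt_hit_from j U V o :
  (hit U o < hit_from (jump_time j o) V o)%E <->
  exists n, U (jump_chain n o) /\
    forall k, (j <= k)%N -> (k <= n)%N -> ~ V (jump_chain k o).
Proof.
split=> [|[n [Un Vn]]].
  move/ereal_inf_lt => [_ [t [t0 Ut] <-] tV].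
  rewrite -(jump_time0 o) in t0.
  have [n [_ Un nt]] := hit_from_time t0 Ut.
  exists n; split=> // k jk kn Vk.
  have := lt_le_trans tV (hit_from_le jk Vk); rewrite lte_fin ltNge => /negP; apply.
  exact: le_trans (jump_time_le _ kn) nt.
apply: (@le_lt_trans _ _ (jump_time n o)%:E).
  by rewrite /hit -(jump_time0 o); exact: hit_from_le.
apply: (@lt_le_trans _ _ (jump_time n.+1 o)%:E); first by rewrite lte_fin jump_time_ltS.
by apply: hit_from_ge => k jk kn; exact: Vn.
Qed.

Lemma avoid0E N : @avoid0 R S N = @before R S (~` eball R N) [set 0].
Proof.
apply/seteqP; split => o; rewrite /avoid0 /exit /= {2}/hit -(jump_time0 o).
  by move/hit_lt_hit_from => [n [Un Vn]]; exists n; split=> // k; exact: Vn.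
by move=> [n [Un Vn]]; apply/hit_lt_hit_from; exists n; split=> // k _; exact: Vn.
Qed.

Lemma avoid0_prob N x :
  fine (P x (@avoid0 R S N)) = @hit_prob R S (~` eball R N) [set 0] x.
Proof. by rewrite avoid0E. Qed.

Lemma avoid_after_prob A N x : A x -> A `<=` eball R N ->
  fine (P x (@avoid_after R S A N)) = avg (@hit_prob R S (~` eball R N) A) x.
Proof.
move=> Ax AN; rewrite -hit_after_probE /hit_after_prob.
have E : @avoid_after R S A N = [set o | exists n, (~` eball R N) (jump_chain n o) /\
    forall k, (1 <= k)%N -> (k <= n)%N -> ~ A (jump_chain k o)].
  apply/seteqP; split => o; rewrite /avoid_after /exit /=.
    by move/(hit_lt_hit_from 1).
  by move=> h; apply/(hit_lt_hit_from 1).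
have m1 : measurable (@avoid_after R S A N).
  rewrite E (_ : [set o | _] = \bigcup_m ([set o | (~` eball R N) (jump_chain m o)] `&`
     \bigcap_(j in [set j | (1 <= j <= m)%N]) [set o | (~` A) (jump_chain j o)])).
    apply: bigcup_measurable => m _; apply: measurableI; first exact: measurable_chain.
    by apply: bigcap_measurableType => j _; exact: measurable_chain.
  apply/seteqP; split => o /=.
    by move=> [m [Um Vm]]; exists m => //; split=> // j /andP[j1 jm]; exact: Vm.
  by move=> [m _ [Um Vm]]; exists m; split=> // j j1 jm; apply: (Vm j); apply/andP.
rewrite (law_start _ m1) (law_start _ (measurable_before_after _ _ _)) E.
congr (fine (P x _)); apply/seteqP; split => o /= [ox [n [Un Vn]]]; split=> //.
  (* The exit cannot occur at time 0, because [x] lies in [A] and therefore in the ball. *)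
  case: n Un Vn => [|n] Un Vn; first by case: Un; rewrite ox; exact: AN.
  by exists n; split=> // k kn; exact: Vn.
by exists n.+1; split=> // -[//|k] _ kn; exact: Vn.
Qed.

Lemma hit_after_set_prob A x y : A x -> ~ A y ->
  fine (P y [set o | (hit_after A o < +oo)%E /\ X (fine (hit_after A o)) o = x]) =
  @hit_prob R S [set x] (A `\ x) y.
Proof.
move=> Ax Ay.
have -> : @hit_prob R S [set x] (A `\ x) y = @hit_after_prob R S [set x] (A `\ x) y.
  rewrite hit_probE; case: asboolP => [[]//|_]; case: asboolP => // /= yx.
  by case: Ay; rewrite yx.
congr (fine (P y _)); apply/seteqP; split => o /=.
  move=> [hfin hX].
  have /ereal_inf_lt[_ [t [t1 At] <-] _] := hfin.
  have [n0 [n01 An0 _]] := hit_from_time t1 At.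
  (* The infimum defining [hit_after] is attained at the jump time of the least positive index at
     which the chain is in [A]. *)
  have ex : exists n, (0 < n)%N && `[< A (jump_chain n o) >].
    by exists n0; rewrite n01; apply/asboolP.
  case: (ex_minnP ex) => -[//|n] /andP[_ /asboolP An] nmin.
  have hE : hit_after A o = (jump_time n.+1 o)%:E.
    apply/eqP; rewrite eq_le hit_from_le//=; apply: hit_from_ge => k k1 kn Ak.
    have := nmin k; rewrite k1 /=; case: asboolP => // _ /(_ isT).
    by rewrite leqNgt kn.
  move: hX; rewrite hE /= X_jump_time => nx.
  exists n; split=> // k kn [Ak kx].
  have := nmin k.+1; case: asboolP => // _ /(_ isT); rewrite ltnS => nk.
  by apply: kx; have -> : k = n by apply/eqP; rewrite eqn_leq kn.
move=> [m [mx Vm]].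
have ex : exists n, (0 < n)%N && `[< A (jump_chain n o) >].
  by exists m.+1; apply/asboolP; rewrite mx.
case: (ex_minnP ex) => -[//|n] /andP[_ /asboolP An] nmin.
have hE : hit_after A o = (jump_time n.+1 o)%:E.
  apply/eqP; rewrite eq_le hit_from_le//=; apply: hit_from_ge => k k1 kn Ak.
  have := nmin k; rewrite k1 /=; case: asboolP => // _ /(_ isT).
  by rewrite leqNgt kn.
rewrite hE /= ltry X_jump_time; split=> //.
have nm : (n <= m)%N.
  by rewrite -ltnS; apply: nmin => /=; apply/asboolP; rewrite mx.
by have := Vm n nm; apply: contra_notP => nx; split.
Qed.

End continuous_time.

(** * Vacancy probabilities of the interlacement *)

(** Direct from the definition of the integral as a supremum over simple functions; it applies to
    the occupation set of a path without a separate proof that this set is measurable. *)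
Lemma ge0_subset_integral_fun d (T : measurableType d) (R : realType)
    (mu : {measure set T -> \bar R}) (f g : T -> \bar R) :
  (forall x, 0 <= f x)%E -> (forall x, f x <= g x)%E ->
  (\int[mu]_x f x <= \int[mu]_x g x)%E.
Proof.
move=> f0 fg; rewrite !ge0_integralTE//; last by move=> x; apply: le_trans (fg x).
apply: ereal_sup_le => _ [h hf <-]; exists h => // x.
exact: le_trans (hf x) (fg x).
Qed.

Section trajectories.
Context {R : realType}.
Implicit Types (w : W R) (x : Z2) (A : set Z2) (t : R).

Lemma path_right_constant w t :
  exists2 e, 0 < e & forall s, t <= s < t + e -> w s = w t.
Proof.
have tw : is_traj w by have := valP w; move/asboolP.
have [e /= e0 H] := traj_right_continuous tw t.
exists e => // s /andP[]; rewrite le_eqVlt => /orP[/eqP ->//|ts] se.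
by apply: H => //=; rewrite distrC ger0_norm ?subr_ge0 ?ltW// ltrBlDl.
Qed.

Definition visiting A : set (W R) := [set w | exists t x, A x /\ w t = Some x].

Lemma measurable_coordinate t (z : option Z2) : measurable [set w : W R | w t = z].
Proof. by apply: sub_sigma_algebra; exists t, z. Qed.

(** By right-continuity a visit lasts for an interval and so contains a rational time. *)
Lemma measurable_visiting A : measurable (visiting A).
Proof.
rewrite (_ : visiting A = \bigcup_(q : rat) \bigcup_x ([set w : W R | A x /\ w (ratr q) = Some x])).
  apply: bigcupT_measurable_rat => q.
  apply: countable_bigcupT_measurable => [|x]; first exact: countableP.
  have [Ax|Ax] := pselect (A x).
    rewrite (_ : [set w : W R | _] = [set w : W R | w (ratr q) = Some x]).
      exact: measurable_coordinate.
    by apply/seteqP; split => w /=; [case|split].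
  by rewrite (_ : [set w : W R | _] = set0)// -subset0 => w [].
apply/seteqP; split => w /=; last first.
  by move=> [q _ [x _ [Ax wx]]]; exists (ratr q), x.
move=> [t [x [Ax wx]]]; have [e e0 we] := path_right_constant w t.
have [|q] := @rat_in_itvoo R t (t + e); first by rewrite ltrDl.
rewrite in_itv /= => /andP[tq qe]; exists q => //; exists x => //; split=> //.
by rewrite we// qe ltW.
Qed.

Lemma pi_star_eq w w' : pi_star w = pi_star w' -> exists s, forall t, w' t = w (t + s).
Proof. by move=> /eqmodP/asboolP. Qed.

Lemma pi_star_visiting A w : Wstar_visiting A (pi_star w) <-> visiting A w.
Proof.
split; last by exists w.
move=> [w' [t [x [Ax w'x]]] /pi_star_eq[s ws]].
by exists (t - s), x; split=> //; rewrite ws subrK.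
Qed.

Lemma pi_star_preimage_visiting A : @pi_star R @^-1` Wstar_visiting A = visiting A.
Proof. by apply/seteqP; split => w /pi_star_visiting. Qed.

Lemma repr_visiting A (a : Wstar R) : Wstar_visiting A a <-> visiting A (repr a).
Proof. by rewrite -pi_star_visiting /pi_star reprK. Qed.

Lemma measurable_Wstar_visiting A : measurable (@Wstar_visiting R A).
Proof.
have : measurable (@pi_star R @^-1` Wstar_visiting A).
  by rewrite pi_star_preimage_visiting; exact: measurable_visiting.
by [].
Qed.

Lemma occupation_time_ge0 x w : (0 <= occupation_time x w)%E.
Proof. by apply: integral_ge0 => t _; rewrite lee_fin. Qed.

Lemma occupation_time_gt0 x w : (0 < occupation_time x w)%E <-> visiting [set x] w.
Proof.
split.
  apply: contraPP => wx; rewrite /occupation_time integral0_eq ?ltxx// => t _.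
  rewrite indicE memNset// => /= wt; apply: wx; exists t, x; split=> //.
move=> [t [_ [-> wt]]]; have [e e0 we] := path_right_constant w t.
apply: (@lt_le_trans _ _ (\int[lebesgue_measure]_s (\1_(`[t, t + e[) s)%:E)%E).
  rewrite integral_indic//= setIT lebesgue_measure_itv /= lte_fin ltrDl e0.
  by rewrite -EFinB lte_fin addrAC subrr add0r.
apply: ge0_subset_integral_fun => s; first by rewrite lee_fin.
rewrite lee_fin !indicE; case: (boolP (s \in `[t, t + e[%classic)) => [|_ //].
rewrite inE /= in_itv /= => /we ws.
by rewrite mem_set//= ws.
Qed.

End trajectories.

(** * Vacancy events of the Poisson process and the mass of the intensity *)

Section point_process.
Context {R : realType}.
Implicit Types (x : Z2) (A : set Z2) (u : R).

Lemma point_count_eq0 (T : Type) (pts : nat -> option T) (B : set T) :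
  point_count pts B = 0%E :> \bar R <-> forall i a, pts i = Some a -> ~ B a.
Proof.
have ge0 i : (0 <= (if pts i is Some a then (\1_B a)%:E else 0) :> \bar R)%E.
  by case: (pts i) => // a; rewrite lee_fin.
split=> [H i a ia Ba|H].
  have : (1 <= point_count pts B :> \bar R)%E.
    rewrite /point_count (nneseriesD1 (n := i))// ia indicE mem_set//.
    by rewrite leeDl// nneseries_ge0.
  by rewrite H lee_fin ler10.
rewrite /point_count eseries0// => i _ _; case ia: (pts i) => [a|//].
by rewrite indicE memNset//; exact: H ia.
Qed.

Lemma interlacement_setP (pts : nat -> option (Wstar R * R)) u x :
  interlacement_set pts u x <->
  exists i a, [/\ pts i = Some a, a.2 <= u & Wstar_visiting [set x] a.1].
Proof.
pose F i := (if pts i is Some a then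
        if (a.2 <= u)%R then occupation_time x (repr a.1) else 0 else 0)%E.
have ge0 i : (0 <= F i)%E.
  by rewrite /F; case: (pts i) => // a; case: ifP => // _; exact: occupation_time_ge0.
split.
  apply: contraPP => H; rewrite /interlacement_set /= /local_time eseries0 ?ltxx// => i _ _.
  case ia: (pts i) => [a|//]; case: ifP => // au.
  apply/eqP/negPn/negP => occ; apply: H; exists i, a; split=> //.
  by apply/repr_visiting/occupation_time_gt0; rewrite lt_neqAle eq_sym occ occupation_time_ge0.
move=> [i [a [ia au /repr_visiting/occupation_time_gt0 H]]].
rewrite /interlacement_set /= /local_time -/F.
apply: (lt_le_trans H); rewrite [leRHS](nneseriesD1 (f := F) (n := i))// {1}/F ia au.
by rewrite leeDl// nneseries_ge0.
Qed.

Lemma interlacement_avoidE (pts : nat -> option (Wstar R * R)) u A :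
  (forall i a, pts i = Some a -> 0 <= a.2) ->
  (forall x, A x -> ~ interlacement_set pts u x) <->
  point_count pts (Wstar_visiting A `*` `[0, u]) = 0%E :> \bar R.
Proof.
move=> a0; rewrite point_count_eq0; split=> [H i a ia [/= [w [t [x [Ax wx]]] wa]]|H x Ax].
  rewrite in_itv /= => /andP[_ au].
  apply: (H x Ax); apply/interlacement_setP; exists i, a; split=> //.
  by exists w => //; exists t, x.
move=> /interlacement_setP[i [a [ia au]]] [w [t [_ [-> wx]]] wa].
apply: (H i a ia); split; first by exists w => //; exists t, x.
by rewrite /= in_itv /= au (a0 _ _ ia).
Qed.

Lemma interlacement_intensityE (nu : {measure set (Wstar R) -> \bar R}) A u :
  0 <= u ->
  interlacement_intensity nu (Wstar_visiting A `*` `[0, u]) =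
  (nu (Wstar_visiting A) * u%:E)%E.
Proof.
move=> u0; rewrite /interlacement_intensity /product_measure1.
rewrite (eq_integral (fun a => (\1_(Wstar_visiting A) a)%:E * u%:E)%E); last first.
  move=> a _; rewrite indicE /=; case: (boolP (a \in _)) => aA.
    rewrite in_xsectionX// mul1e /mrestr.
    rewrite (_ : _ `&` _ = `[0, u]%classic).
      rewrite lebesgue_measure_itv /= lte_fin; case: ltP => [_|u0'].
        by rewrite -EFinB subr0.
      by congr (_%:E); apply/le_anti; rewrite u0.
    by apply/setIidl => s; rewrite /= !in_itv /= => /andP[->].
  by rewrite notin_xsectionX// mul0e /mrestr set0I measure0.
rewrite ge0_integralZr//.
- by rewrite integral_indic ?setIT//; exact: measurable_Wstar_visiting.
- by apply/measurable_EFinP; apply: measurable_indic; exact: measurable_Wstar_visiting.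
Qed.

Section law.
Context d (O : measurableType d) (P : probability O R)
  (nu : {finite_measure set (Wstar R) -> \bar R})
  (pts : O -> nat -> option (Wstar R * R)) (u : R).
Hypothesis u0 : 0 <= u.
Hypothesis ip : interlacement_process P nu pts.

Lemma interlacement_avoid_event A :
  [set o | forall x, A x -> ~ interlacement_set (pts o) u x] =
  [set o | point_count (pts o) (Wstar_visiting A `*` `[0, u]) = 0%E :> \bar R].
Proof.
by apply/seteqP; split => o /=; rewrite interlacement_avoidE//; exact: (level_ge0 ip).
Qed.

Let mB A : measurable (@Wstar_visiting R A `*` `[0, u]%classic).
Proof. by apply: measurableX => //; exact: measurable_Wstar_visiting. Qed.

Lemma measurable_interlacement_avoid A :
  measurable [set o | forall x, A x -> ~ interlacement_set (pts o) u x].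
Proof.
rewrite interlacement_avoid_event.
have := ppm_measurable (interlacement_ppm ip) (mB A).
move=> /(_ measurableT [set 0%E]); rewrite setTI; apply; exact: emeasurable_set1.
Qed.

Lemma interlacement_avoid_prob A :
  P [set o | forall x, A x -> ~ interlacement_set (pts o) u x] =
  (expR (- (fine (nu (Wstar_visiting A)) * u)))%:E.
Proof.
rewrite interlacement_avoid_event.
have := @ppm_finite _ _ _ _ _ _ _ _ (interlacement_ppm ip) _ (fine (nu (Wstar_visiting A)) * u) 0 (mB A).
rewrite expr0 mulr1 fact0 divr1; apply.
rewrite interlacement_intensityE// EFinM fineK// fin_num_measure//.
exact: measurable_Wstar_visiting.
Qed.

End law.

(** The mass is the total mass of [Q], split according to the starting point [w 0]; [Q_law] is used
    with the sure events for both halves of the path. *)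
Lemma nu_visiting (S : srw R) N (nu : {measure set (Wstar R) -> \bar R}) A :
  is_nu S N nu -> finite_set A -> A 0 -> A `<=` eball R N ->
  nu (Wstar_visiting A) =
  (\sum_(x \in A) (fine (srw_law S x (@avoid_after R S A N)) * fine (srw_law S x (@avoid0 R S N))))%:E.
Proof.
move=> nuN Af A0 AN; have [Q QQ nuQ] := nu_restricted nuN A0 AN.
have := nuQ setT measurableT; rewrite setTI preimage_setT => ->.
have mx x : measurable [set w : W R | w 0 = Some x] by exact: measurable_coordinate.
pose V := \bigcup_(x in A) [set w : W R | w 0 = Some x].
have mV : measurable V by apply: fin_bigcup_measurable.
have -> : Q setT = Q V.
  rewrite -(setvU V) measureU//; [|exact: measurableC|by rewrite setICl].
  rewrite [X in (X + _)%E](_ : _ = 0%E) ?add0e//.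
  rewrite (_ : ~` V = [set w : W R | ~ exists2 x, A x & w 0 = Some x]).
    exact: Q_start QQ.
  by apply/seteqP; split => w /= h; apply: contra_not h => -[x Ax wx]; exists x.
rewrite measure_fin_bigcup//; last first.
  by apply/trivIsetP => x y _ _ /eqP xy; rewrite -subset0 => w [/= -> [] ].
rewrite -fsumEFin//; apply: eq_fsbigr => x /set_mem Ax.
have T1 (I : set R) : coord_sigma I [set: traj R].
  by move=> C [[C0 CC _] _]; rewrite -(setD0 setT); exact: CC.
have := Q_law QQ Ax (T1 _) (T1 _).
rewrite (_ : [set w : W R | _] = [set w : W R | w 0 = Some x]); last first.
  by apply/seteqP; split => w /=; [case|].
rewrite (_ : [set o : S | setT (forward_path N o)] = setT)//.
move=> H; apply: (etrans H); congr (_%:E); rewrite /cond_prob !setTI.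
(* The conditional probability of the sure event reads [p / p], which is 0 when [p = 0]; the
   prefactor then vanishes as well. *)
have div1 (p : R) : p * (p / p) = p.
  by have [->|p0] := eqVneq p 0; [rewrite mul0r|rewrite divff// mulr1].
have cancel (p q : R) : p * q * (q / q) * (p / p) = p * q.
  by rewrite -(mulrA p) div1 mulrAC div1.
exact: cancel.
Qed.

End point_process.

(** * Finite-dimensional marginals *)

Section cylinders.
Context d (T : measurableType d) (R : realType) (P : probability T R)
  (xi : T -> config).
Implicit Types (x : Z2) (Z L : seq Z2).
Hypothesis xi_measurable : forall x, measurable [set o | xi o x = false].

Definition cylinder Z L : set T :=
  [set o | all (fun x => ~~ xi o x) Z && all (xi o) L].

(** One step of inclusion-exclusion: an occupied site in [L] is traded for the same site being
    vacant in [Z]. *)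
Lemma cylinder_cons Z L x : cylinder Z (x :: L) = cylinder Z L `\` cylinder (x :: Z) L.
Proof.
apply/seteqP; split => o; rewrite /cylinder /=; first by case: (xi o x) => //=; rewrite andbF.
by case: (xi o x) => /= -[->].
Qed.

Lemma measurable_cylinder Z L : measurable (cylinder Z L).
Proof.
elim: L Z => [|x L IH] Z; last by rewrite cylinder_cons; exact: measurableD.
elim: Z => [|x Z IH].
  by rewrite (_ : cylinder _ _ = setT)//; apply/seteqP; split.
rewrite (_ : cylinder _ _ = [set o | xi o x = false] `&` cylinder Z [::]); first exact: measurableI.
apply/seteqP; split => o; rewrite /cylinder /= !andbT.
  by move=> /andP[/negbTE].
by move=> [-> ->].
Qed.

Lemma cylinder_prob_cons Z L x : fine (P (cylinder Z (x :: L))) =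
  fine (P (cylinder Z L)) - fine (P (cylinder (x :: Z) L)).
Proof.
have mZ := measurable_cylinder Z L; have mxZ := measurable_cylinder (x :: Z) L.
rewrite cylinder_cons measureD ?(le_lt_trans (probability_le1 _ _)) ?ltry//.
rewrite (setIidr (_ : cylinder (x :: Z) L `<=` cylinder Z L)); last first.
  by move=> o; rewrite /cylinder /= => /andP[/andP[_ ->] ->].
by rewrite fineB// fin_num_measure.
Qed.

Lemma cylinder_integral n (z : 'I_n -> Z2) (f : {ffun 'I_n -> bool} -> R) :
  (\int[P]_o (f [ffun i => xi o (z i)])%:E)%E =
  (\sum_b f b * fine (P (cylinder [seq z i | i <- enum 'I_n & ~~ b i]
                                  [seq z i | i <- enum 'I_n & b i])))%:E.
Proof.
pose C (b : {ffun 'I_n -> bool}) := cylinder [seq z i | i <- enum 'I_n & ~~ b i]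
                                  [seq z i | i <- enum 'I_n & b i].
have CE b o : C b o <-> b = [ffun i => xi o (z i)].
  rewrite /C /cylinder /=; split.
    rewrite !all_map => /andP[/allP h0 /allP h1]; apply/ffunP => i; rewrite ffunE.
    have iE : i \in enum 'I_n by rewrite mem_enum.
    case bi: (b i).
      by have := h1 i; rewrite mem_filter bi iE /= => /(_ isT) ->.
    by have := h0 i; rewrite mem_filter bi iE /= => /(_ isT) /negbTE ->.
  move=> ->; rewrite !all_map; apply/andP; split; apply/allP => i; rewrite mem_filter ffunE /= => /andP[] //.
have mC b : measurable (C b) by exact: measurable_cylinder.
rewrite (eq_integral (fun o => \sum_b ((f b)%:E * (\1_(C b) o)%:E))%E); last first.
  move=> o _; rewrite (bigD1 [ffun i => xi o (z i)])//= big1 ?adde0.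
    by rewrite indicE mem_set ?mule1//; apply/CE.
  move=> b bo; rewrite indicE memNset ?mule0// => /CE bE.
  by rewrite bE eqxx in bo.
have int1 b : P.-integrable setT (fun o => (\1_(C b) o)%:E).
  apply: integrable_indic => //.
rewrite integral_sum//; last by move=> b; apply: integrableZl.
rewrite -sumEFin; apply: eq_bigr => b _.
rewrite integralZl// integral_indic// setIT EFinM fineK//.
by rewrite fin_num_measure//; exact: mC.
Qed.

End cylinders.

Lemma probability_setI_full d (T : measurableType d) (R : realType)
    (P : probability T R) (E F : set T) :
  measurable E -> measurable F -> P F = 1%E -> P (E `&` F) = P E.
Proof.
move=> mE mF F1; rewrite [RHS](@measureDI _ _ _ P E F)//.
rewrite [X in _ = (X + _)%E](_ : _ = 0%E) ?add0e//.
apply/eqP; rewrite eq_le measure_ge0 andbT.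
have <- : P (~` F) = 0%E by rewrite probability_setC// F1 subee.
apply: le_measure; rewrite ?inE; [exact: measurableD|exact: measurableC|].
by move=> o [].
Qed.

(** Integrals of functions of finitely many sites are finite sums of cylinder probabilities, and
    induction on the list of occupied sites reduces these to vacancy probabilities. *)
Lemma fdd_weak_cvg_zero (R : realType) (d : nat -> measure_display)
    (O : forall N, measurableType (d N)) (P : forall N, probability (O N) R)
    (xi : forall N, O N -> config) (Q : probability config R) :
  (forall N x, (1 <= N)%N -> measurable [set o | xi N o x = false]) ->
  (forall Z, fine (P N (cylinder (xi N) Z [::])) @[N --> \oo] -->
             fine (Q (cylinder idfun Z [::]))) ->
  fdd_weak_cvg P xi Q.
Proof.
move=> mxi cvg0 n z f.
have mQ x : measurable [set y : config | idfun y x = false].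
  by apply: sub_sigma_algebra; exists x, false.
have cvgZL L Z : fine (P N (cylinder (xi N) Z L)) @[N --> \oo] -->
             fine (Q (cylinder idfun Z L)).
  elim: L Z => [//|x L IH] Z; rewrite (cylinder_prob_cons Q mQ).
  apply: cvg_trans (cvgB (IH Z) (IH (x :: Z))); apply: near_eq_cvg.
  exists 1%N => // N /= N1; rewrite /= cylinder_prob_cons// => y; exact: mxi.
rewrite (cylinder_integral Q mQ z).
apply: cvg_trans (_ : EFin \o (fun N => \sum_b f b *
    fine (P N (cylinder (xi N) [seq z i | i <- enum 'I_n & ~~ b i]
                                  [seq z i | i <- enum 'I_n & b i]))) @ \oo --> _).
  apply: near_eq_cvg; exists 1%N => // N /= N1.
  by rewrite /= (cylinder_integral (P N) (fun y => mxi N y N1) z).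
apply: cvg_EFin; first exact: nearW.
apply: cvg_sumr => b; apply: cvgM; first exact: cvg_cst.
exact: cvgZL.
Qed.

(** * Capacity asymptotics *)

Section capacity_limit.
Context {R : realType} (S : srw R).
Implicit Types (x y : Z2) (A : set Z2) (N : nat).
Local Notation a := (@potential_kernel R).

Lemma near_infinity_notin A : finite_set A -> \forall y \near at_infinity R, ~ A y.
Proof.
move=> /finite_seqP[s ->].
elim: s => [|x s IH]; first exact: nearW.
have := near_infinity_gt (@nsq R x); move: IH; apply: filterS2 => y /= ys xy.
by rewrite inE => /orP[/eqP yx|//]; rewrite yx ltxx in xy.
Qed.

Lemma finite_set_enum A x : finite_set A -> A x ->
  exists n (z : 'I_n -> Z2) i, [/\ injective z, range z = A & z i = x].
Proof.
move=> /finite_seqP[s sE] Ax; pose r := undup s.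
have Ar y : A y <-> y \in r by rewrite sE /r mem_undup.
exists (size r), (fun i => nth 0 r i); have xr : x \in r by apply/Ar.
have xs : (index x r < size r)%N by rewrite index_mem.
exists (Ordinal xs); split; last by rewrite /= nth_index.
- move=> i j /eqP; rewrite nth_uniq ?undup_uniq// => /eqP; exact: val_inj.
- apply/seteqP; split => [_ [i _ <-]|y /Ar yr]; first by apply/Ar; rewrite mem_nth.
  have ys : (index y r < size r)%N by rewrite index_mem.
  by exists (Ordinal ys) => //=; rewrite nth_index.
Qed.

Lemma escape_prob_cvg A (g : Z2 -> R) (C : R) y :
  (forall x, A x -> g x = 0) -> (forall x, ~ A x -> avg g x = g x) ->
  (\forall x \near at_infinity R, `|g x - ln (1 + nsq x) / pi| <= C) ->
  (ln N%:R * hit_prob S (~` eball R N) A y) @[N --> \oo] --> pi / 2%:R * g y.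
Proof.
move=> gA gh gC; apply: (@escape_asymptotics R A g (fun N => hit_prob S (~` eball R N) A) C y gA gh gC).
- by move=> N x; exact: hit_prob_ge0.
- by move=> N x Ax; rewrite hit_probE; case: asboolP.
- by move=> N x Ax xN; rewrite hit_probE; case: asboolP => // _; case: asboolP.
- move=> N x Ax xN; rewrite -hit_after_probE [RHS]hit_probE.
  by case: asboolP => // _; case: asboolP.
Qed.

Lemma avoid0_cvg x :
  (ln N%:R * fine (srw_law S x (@avoid0 R S N))) @[N --> \oo] --> pi / 2%:R * a x.
Proof.
under eq_fun do rewrite avoid0_prob.
apply: (@escape_prob_cvg [set 0] a 9%:R).
- by move=> _ ->; exact: potential_kernel0.
- move=> y y0; rewrite avg_potential_kernel.
  by case: eqP => [/y0//|_]; rewrite addr0.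
- by apply: nearW => y; exact: potential_kernel_log.
Qed.

Lemma eball_cover A : finite_set A -> \forall N \near \oo, A `<=` eball R N.
Proof.
move=> /finite_seqP[s ->]; elim: s => [|x s IH]; first exact: nearW.
near=> N; move=> y /=; rewrite inE => /orP[/eqP ->|ys].
  rewrite /eball /=; near: N.
  exists (Num.trunc (enorm R x)).+1 => // N /= xN.
  by apply: ltW; apply: lt_le_trans (truncnS_gt _) _; rewrite ler_nat.
by have : [set` s] `<=` eball R N; [near: N|apply].
Unshelve. all: by end_near. Qed.

(** The probability is the mean over the neighbours of [x] of escape probabilities asymptotic to
    [g], and [avg g x] is the charge of [x], identified with harmonic measure. *)
Lemma avoid_after_cvg A x : finite_set A -> A 0 -> A x ->
  (ln N%:R * fine (srw_law S x (@avoid_after R S A N))) @[N --> \oo] -->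
  pi / 2%:R * harmonic_measure S A x.
Proof.
move=> Af A0 Ax.
have [n [z [i0 [z_inj zA z0]]]] := finite_set_enum Af A0.
have [q [g [gA gh gq [C gC] hmq]]] := equilibrium z_inj z0 (R := R).
rewrite zA in gA gh hmq.
have [i _ ix] : range z x by rewrite zA.
have hmE : harmonic_measure S A x = q i.
  apply: cvg_lim => //.
  have : hit_prob S [set x] (A `\ x) y @[y --> at_infinity R] --> q i.
    apply: hmq.
    - by move=> y; rewrite ger0_norm ?hit_prob_ge0// hit_prob_le1.
    - move=> y Ay; rewrite -hit_after_probE [RHS]hit_probE.
      case: asboolP => [[]//|_]; case: asboolP => // /= yx.
      by case: Ay; rewrite yx.
    - move=> j; rewrite hit_probE; have Aj : A (z j) by rewrite -zA; exists j.
      have [->|ji] := eqVneq j i.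
        rewrite ix asboolF; last by move=> [_ /(_ erefl)].
        by rewrite asboolT.
      rewrite asboolT//; split=> // /= zj.
      by move: ji; rewrite -(inj_eq z_inj) zj ix eqxx.
  move=> H; apply: cvg_trans H; apply: near_eq_cvg.
  apply: filterS (near_infinity_notin Af) => y Ay.
  by rewrite hit_after_set_prob.
rewrite hmE.
have : (ln N%:R * avg (hit_prob S (~` eball R N) A) x) @[N --> \oo] --> pi / 2 * avg g x.
  rewrite -avgZ; under eq_fun do rewrite -avgZ.
  by apply: cvg_avg => k; apply: (@escape_prob_cvg A g C).
rewrite -{2}ix gq => H; apply: cvg_trans H; apply: near_eq_cvg.
by apply: filterS (eball_cover Af) => N AN; rewrite avoid_after_prob.
Qed.

Lemma capacity_set1 : capacity S [set 0] = 0.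
Proof. by rewrite /capacity fsbig_set1 potential_kernel0 mul0r. Qed.

(** Each of the two escape probabilities absorbs one factor [ln N], and the constants combine as
    [(2 / pi) (pi / 2)^2 = pi / 2]. *)
Lemma interlacement_capacity_cvg (alpha : R) (u : nat -> R)
    (nu : nat -> {finite_measure set (Wstar R) -> \bar R}) A :
  0 < alpha ->
  u N / (2%:R / pi * alpha * ln N%:R ^+ 2) @[N --> \oo] --> (1 : R) ->
  (forall N, (1 <= N)%N -> is_nu S N (nu N)) ->
  finite_set A -> A 0 ->
  (fine (nu N (Wstar_visiting A)) * u N) @[N --> \oo] -->
  pi / 2%:R * alpha * capacity S A.
Proof.
move=> a0 uN nuN Af A0.
have p0 : pi != 0 :> R by rewrite gt_eqF// pi_gt0.
have [s sE] : exists s : seq Z2, forall f : Z2 -> R,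
    \sum_(x \in A) f x = \sum_(x <- s) f x /\ [set` s] = A.
  exists (finmap.enum_fset (fset_set A)) => f; split; first exact: fsbig_finite.
  by rewrite -[RHS]fset_setK.
have sA x : x \in s -> A x by move=> xs; have [_ <-] := sE (fun=> 0).
pose e N x := fine (srw_law S x (@avoid_after R S A N)).
pose h N x := fine (srw_law S x (@avoid0 R S N)).
have H : (u N / (2%:R / pi * alpha * ln N%:R ^+ 2) *
    (2%:R / pi * alpha * \sum_(x <- s) ((ln N%:R * e N x) * (ln N%:R * h N x))))
    @[N --> \oo] --> 1 * (2%:R / pi * alpha *
       \sum_(x <- s) (if x \in s then (pi / 2%:R * harmonic_measure S A x) * (pi / 2%:R * a x) else 0)).
  apply: cvgM => //; apply: cvgM; first exact: cvg_cst.
  (* [cvg_sumr] asks for a limit at every index, whereas [avoid_after_cvg] provides it on [A] only;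
     the conditional supplies 0 elsewhere. *)
  rewrite (_ : (fun N => _) = (fun N => \sum_(x <- s)
      if x \in s then ln N%:R * e N x * (ln N%:R * h N x) else 0)); last first.
    by apply/funext => N; apply: eq_big_seq => x ->.
  apply: cvg_sumr => x; case: ifPn => [xs|_]; last exact: cvg_cst.
  by apply: cvgM; [apply: avoid_after_cvg => //; exact: sA|exact: avoid0_cvg].
rewrite [X in _ --> X](_ : _ = 1 * (2%:R / pi * alpha *
       \sum_(x <- s) (if x \in s then (pi / 2%:R * harmonic_measure S A x) * (pi / 2%:R * a x) else 0))).
  apply: cvg_trans H; apply: near_eq_cvg.
  near=> N.
  have N1 : (1 <= N)%N by near: N; exists 1%N.
  have AN : A `<=` eball R N by near: N; exact: eball_cover.
  have lnN : 1 <= ln N%:R :> R by near: N; exact: near_ln_ge.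
  rewrite (nu_visiting (nuN N N1) Af A0 AN) /= (sE _).1.
  under eq_bigr do rewrite mulrACA -expr2.
  rewrite -mulr_sumr; move: (\sum_(x <- s) _) (u N) => v w.
  have l0 : ln N%:R != 0 :> R by rewrite gt_eqF//; lra.
  move: (ln _) l0 => l l0; move: pi p0 => p p0.
  by field; rewrite p0 l0 /= gt_eqF.
rewrite mul1r /capacity (sE _).1.
rewrite [X in _ = _ * X](eq_big_seq (fun x => (pi / 2) ^+ 2 * (a x * harmonic_measure S A x))); last first.
  by move=> x ->; ring.
rewrite -mulr_sumr; move: (\sum_(x <- s) _) => v; move: pi p0 => p p0.
by field.
Unshelve. all: by end_near. Qed.

End capacity_limit.

(** * Weak convergence of the occupied set *)

Theorem proposition3p1 (R : realType) (S : srw R) (alpha : R) (u : nat -> R)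
    (nu : nat -> {finite_measure set (Wstar R) -> \bar R})
    (d : nat -> measure_display) (Omega : forall N, measurableType (d N))
    (P : forall N, probability (Omega N) R)
    (omega : forall N, Omega N -> nat -> option (Wstar R * R))
    (Q : probability config R) :
  0 < alpha ->
  (forall N, (1 <= N)%N -> 0 < u N) ->
  u N / (2%:R / pi * alpha * ln N%:R ^+ 2) @[N --> \oo] --> (1 : R) ->
  (forall N, (1 <= N)%N -> is_nu S N (nu N)) ->
  (forall N, (1 <= N)%N -> interlacement_process (P N) (nu N) (omega N)) ->
  is_Qalpha S alpha Q ->
  fdd_weak_cvg P
    (fun N o x => `[< interlacement_set (omega N o) (u N) x >]) Q.
Proof.
move=> a0 u0 uN nuN ip Qa.
have uge N : (1 <= N)%N -> 0 <= u N by move=> /u0 /ltW.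
pose xi N (o : Omega N) : config := fun x => `[< interlacement_set (omega N o) (u N) x >].
have xi_cyl N Z : cylinder (xi N) Z [::] =
    [set o | forall x, [set` Z] x -> ~ interlacement_set (omega N o) (u N) x].
  apply/seteqP; split => o; rewrite /cylinder /= andbT.
    by move=> /allP H x xZ; apply/asboolPn; exact: H.
  by move=> H; apply/allP => x xZ; apply/asboolPn; exact: H.
have Q_cyl Z : cylinder idfun Z [::] = [set y : config | forall x, [set` Z] x -> y x = false].
  apply/seteqP; split => y; rewrite /cylinder /= andbT.
    by move=> /allP H x xZ; apply/negbTE; exact: H.
  by move=> H; apply/allP => x xZ; rewrite H.
have mxi N x : (1 <= N)%N -> measurable [set o | xi N o x = false].
  move=> N1.
  rewrite (_ : [set o | _] =
      [set o | forall y, [set x] y -> ~ interlacement_set (omega N o) (u N) y]).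
    exact: measurable_interlacement_avoid (u N) (ip N N1) [set x].
  apply/seteqP; split => o /=; first by move=> /negbT/asboolPn H _ ->.
  by move=> H; apply/negbTE/asboolPn; exact: H.
have mQ x : measurable [set y : config | idfun y x = false].
  by apply: sub_sigma_algebra; exists x, false.
apply: fdd_weak_cvg_zero => // Z.
(* The capacity formula speaks of sets containing the origin only. As [{0}] has capacity 0, the
   origin is vacant almost surely under [Q] and can be added to any [Z]. *)
have Q0 : fine (Q (cylinder idfun (0 :: Z) [::])) = fine (Q (cylinder idfun Z [::])).
  rewrite -(@probability_setI_full _ _ _ Q (cylinder idfun Z [::]) [set y : config | y 0 = false])//.
  - congr (fine (Q _)); apply/seteqP; split => y; rewrite /cylinder /= !andbT.
      by move=> /andP[/negbTE].
    by move=> [-> ->].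
  - exact: measurable_cylinder.
  - have := Qa _ (finite_set1 0) erefl; rewrite capacity_set1 mulr0 expR0 => <-.
    congr (Q _); apply/seteqP; split => y /=; first by move=> y0 x ->.
    by move=> H; exact: H.
rewrite -Q0.
have key : expR (- (fine (nu N (Wstar_visiting [set` 0 :: Z])) * u N)) @[N --> \oo] -->
    fine (Q (cylinder idfun (0 :: Z) [::])).
  have A0 : [set` 0 :: Z] (0 : Z2) by rewrite /= mem_head.
  have Af : finite_set [set` 0 :: Z] by exact: finite_seq.
  rewrite Q_cyl (Qa _ Af A0) /= !mulNr.
  apply: continuous_cvg; first exact: continuous_expR.
  by apply: cvgN; exact: (interlacement_capacity_cvg a0 uN nuN Af A0).
apply: cvg_trans key; apply: near_eq_cvg.
exists 1%N => // N /= N1.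
have avoid_prob A := interlacement_avoid_prob (uge N N1) (ip N N1) A.
rewrite -[LHS]/(fine (_%:E)) -avoid_prob -xi_cyl.
rewrite -(@probability_setI_full _ _ _ (P N) (cylinder (xi N) Z [::]) [set o | xi N o 0 = false]).
- congr (fine (P N _)); apply/seteqP; split => o; rewrite /cylinder /= !andbT.
    by move=> /andP[/negbTE].
  by move=> [-> ->].
- by apply: measurable_cylinder => x; exact: mxi.
- exact: mxi.
(* The same holds before the limit: from 0 the walk cannot leave the ball before hitting 0, so no
   trajectory of the intensity visits the origin, up to a null set. *)
- have := avoid_prob [set 0].
  rewrite (nu_visiting (nuN N N1))//; last first.
    by move=> _ ->; rewrite /eball /= enormE /nsq /= expr0n addr0 sqrtr0.
  rewrite fsbig_set1 avoid0_prob hit_probE asboolT//.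
  rewrite mulr0 mul0r oppr0 expR0 => <-.
  congr (P N _); apply/seteqP; split => o /=; first by move=> /negbT/asboolPn H _ ->.
  by move=> H; apply/negbTE/asboolPn; exact: H.
Qed.
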